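(* Let $U,V$ be finite-dimensional weak Hopf algebras over $\mathbb C$ and let $p:U\times V\to\mathbb C$ be a non-degenerate skew-pairing. Let $J\subset U\otimes V$ be the linear span of the elements $$u\otimes xv-u(x\rightharpoonup 1_U)\otimes v,\qquad u\otimes yv-u(1_U\leftharpoonup y)\otimes v\qquad(u\in U,\ v\in V,\ x\in V_L,\ y\in V_R),$$ and write $[u\otimes v]$ for the class of $u\otimes v$ in $(U\otimes V)/J$. Then the formulas $$1=[1_U\otimes 1_V],$$ $$[u\otimes v][u'\otimes v']=\sum[u\,u'^{(2)}\otimes v^{(2)}v']\;p(u'^{(1)},v^{(1)})\,p(u'^{(3)},S^{-1}(v^{(3)})),$$ $$\Delta([u\otimes v])=\sum[u^{(1)}\otimes v^{(1)}]\otimes[u^{(2)}\otimes v^{(2)}],$$ $$\varepsilon([u\otimes v])=p\big(u,\varepsilon_R(S^{-1}(v))\big),$$ $$S([u\otimes v])=\sum[S(u^{(2)})\otimes S(v^{(2)})]\;p(u^{(3)},v^{(3)})\,p(u^{(1)},S^{-1}(v^{(1)}))$$ equip $(U\otimes V)/J$ with the structure of a weak Hopf algebra.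
   Context: Sweedler notation $\Delta(u)=\sum u^{(1)}\otimes u^{(2)}$ refers here to the comultiplication of $U$ and of $V$ themselves (not to the co-opposite $U^{\rm cop}$). For a weak Hopf algebra $W$ (in the sense of Böhm–Nill–Szlachányi), $\varepsilon_L(w)=\sum\varepsilon(1^{(1)}w)1^{(2)}$, $\varepsilon_R(w)=\sum 1^{(1)}\varepsilon(w1^{(2)})$, $W_L=\varepsilon_L(W)$, $W_R=\varepsilon_R(W)$. Antipodes are invertible by finite-dimensionality. Skew-pairing: a bilinear map $p:U\times V\to\mathbb C$ with $p(1_U,v)=\varepsilon_V(v)$, $p(u,1_V)=\varepsilon_U(u)$, $p(uu',v)=\sum p(u,v^{(1)})p(u',v^{(2)})$, $p(u,vv')=\sum p(u^{(2)},v)p(u^{(1)},v')$, $p(S_U(u),v)=p(u,S_V^{-1}(v))$. It is non-degenerate if $p(u,\cdot)=0$ implies $u=0$ and $p(\cdot,v)=0$ implies $v=0$. Arrows: for $u\in U$, $v\in V$, $v\rightharpoonup u=\sum p(u^{(1)},v)\,u^{(2)}$ and $u\leftharpoonup v=\sum u^{(1)}\,p(u^{(2)},v)$. *)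

(* Defs.v *)
From HB Require Import structures.
From mathcomp Require Import all_boot all_order all_algebra sesquilinear.
From mathcomp Require Import boolp classical_sets reals.
From mathcomp Require Import complex.

Set Implicit Arguments.
Unset Strict Implicit.
Unset Printing Implicit Defensive.

Import GRing.Theory.
Local Open Scope ring_scope.
Local Open Scope classical_set_scope.

Section TensorProduct.
Variable K : fieldType.
Implicit Types U V : vectType K.

(* The tensor product, modelled by coordinate matrices with respect to the
   chosen bases [vbasis]; [tens_bilinear], [tlift_linear], [tlift_tens] and
   [tensor_span] below are its universal property. *)
Definition tensor U V : vectType K := 'M[K]_(\dim {:U}, \dim {:V}).

Definition tens U V (u : U) (v : V) : tensor U V :=
  \matrix_(i, j) (coord (vbasis {:U}) i u * coord (vbasis {:V}) j v).

(* For bilinear f, the linear map [tensor U V -> W] sending u ⊗ v to f u v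
   (for other f the value depends on the bases and has no meaning). *)
Definition tlift U V (W : lmodType K) (f : U -> V -> W) (t : tensor U V) : W :=
  \sum_i \sum_j (t : 'M_(_, _)) i j *: f (vbasis {:U})`_i (vbasis {:V})`_j.

Fact tens_bilinear U V : bilinear_for *:%R *:%R (@tens U V).
Proof.
split=> [v|u] a x y; apply/matrixP=> i j; rewrite !mxE linearP /=.
  by rewrite mulrDl mulrA.
by rewrite mulrDr mulrCA.
Qed.

HB.instance Definition _ U V :=
  bilinear_isBilinear.Build K U V (tensor U V) _ _ (@tens U V)
    (@tens_bilinear U V).

Lemma tlift_linear U V (W : lmodType K) (f : U -> V -> W) : linear (tlift f).
Proof.
move=> a s t; rewrite /tlift scaler_sumr -big_split /=; apply: eq_bigr => i _.
rewrite scaler_sumr -big_split /=; apply: eq_bigr => j _.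
by rewrite !mxE scalerDl scalerA.
Qed.

Lemma tlift_tens U V (W : lmodType K) (f : {bilinear U -> V -> W}) u v :
  tlift f (tens u v) = f u v.
Proof.
rewrite {2}(coord_vbasis (memvf u)) {2}(coord_vbasis (memvf v)) /tlift.
rewrite linear_sumlz /=; apply: eq_bigr => i _.
rewrite linear_sumr /=; apply: eq_bigr => j _.
by rewrite mxE linearZl_LR linearZr_LR /= scalerA.
Qed.

Lemma tensor_span U V (t : tensor U V) : tlift (@tens U V) t = t.
Proof.
have bE (W : vectType K) (i k : 'I_(\dim {:W})) :
    coord (vbasis {:W}) i (vbasis {:W})`_k = (i == k)%:R.
  by rewrite coord_free ?(basis_free (vbasisP _)) // eq_sym.
apply/matrixP=> k l; rewrite /tlift summxE (bigD1 k) //= summxE (bigD1 l) //=.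
rewrite !mxE !bE !eqxx !mulr1 !big1 ?addr0 // => [i ne|j ne].
  by rewrite summxE big1 // => j _; rewrite !mxE !bE [k == i]eq_sym (negPf ne) mul0r mulr0.
by rewrite !mxE !bE [l == j]eq_sym (negPf ne) !mulr0.
Qed.

End TensorProduct.

Notation "u ⊗ v" := (tens u v) (at level 40, left associativity) : ring_scope.

Section SpanAndQuotient.
Variables (K : fieldType) (A : vectType K).

Fact lspan_subproof (X : set A) : exists W : {vspace A}, forall t,
  t \in W <-> exists (n : nat) (s : 'I_n -> A) (c : 'I_n -> K),
    (forall i, X (s i)) /\ t = \sum_i c i *: s i.
Proof.
pose Q d := `[< exists s : seq A,
  (forall t, t \in s -> X t) /\ \dim <<s>>%VS = d >].
have exQ : exists d, Q d.
  by exists 0; apply/asboolP; exists [::]; split=> //; rewrite span_nil dimv0.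
have ubQ d : Q d -> (d <= \dim {:A})%N.
  by case/asboolP=> s [_ <-]; apply/dimvS/subvf.
have [d /asboolP[s [sX <-]] dmax] := ex_maxnP exQ ubQ.
exists <<s>>%VS => t; split=> [ts|[n [r [c [rX ->]]]]].
  exists (size s), (fun i => s`_i), (fun i => coord (in_tuple s) i t).
  split=> [i|]; first by apply: sX; rewrite mem_nth.
  exact: (coord_span (X := in_tuple s)).
apply: memv_suml => i _; apply: memvZ.
have /dmax : Q (\dim <<r i :: s>>%VS).
  apply/asboolP; exists (r i :: s); split=> // x; rewrite inE.
  by case/predU1P=> [->|/sX].
have sub : (<<s>> <= <<r i :: s>>)%VS by rewrite span_cons addvSr.
move=> le_dim; have /eqP-> : <<s>>%VS == <<r i :: s>>%VS.
  by rewrite eqEdim sub.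
by rewrite memv_span // mem_head.
Qed.

Definition lspan (X : set A) : {vspace A} := sval (cid (lspan_subproof X)).

Lemma lspanP (X : set A) t :
  t \in lspan X <-> exists (n : nat) (s : 'I_n -> A) (c : 'I_n -> K),
    (forall i, X (s i)) /\ t = \sum_i c i *: s i.
Proof. exact: (svalP (cid (lspan_subproof X))). Qed.

(* A/J, modelled on the complement of J chosen by the library; the class map
   is the projection along J: see [limg_quo] and [lker_quo]. *)
Definition quotv (J : {vspace A}) : vectType K := subvs_of J^C.

Definition quo (J : {vspace A}) : 'Hom(A, quotv J) :=
  linfun (vsproj J^C \o daddv_pi J^C J).

Lemma quoE J t : vsval (quo J t) = daddv_pi J^C J t.
Proof. by rewrite lfunE /= vsprojK ?memv_pi. Qed.

Lemma limg_quo J : limg (quo J) = fullv.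
Proof.
apply/eqP; rewrite eqEsubv subvf; apply/subvP=> y _.
have -> : y = quo J (vsval y).
  apply: val_inj; rewrite /= quoE daddv_pi_id ?subvsP //.
  by rewrite capvC capv_compl.
by rewrite memv_img ?memvf.
Qed.

Lemma lker_quo J : lker (quo J) = J.
Proof.
have dJ : (J^C :&: J = 0)%VS by rewrite capvC capv_compl.
apply/vspaceP=> t; rewrite memv_ker.
have tE : daddv_pi J^C J t + daddv_pi J J^C t = t.
  by apply: daddv_pi_add; rewrite // addvC addv_complf memvf.
apply/eqP/idP=> [/(congr1 vsval)|tJ].
  by rewrite quoE /= => t0; rewrite -tE t0 add0r memv_pi.
apply: val_inj; rewrite /= quoE.
move: tE; rewrite (daddv_pi_id _ tJ) ?capv_compl // => /(canRL (addrK t)) ->.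
by rewrite subrr.
Qed.

End SpanAndQuotient.

Section WeakHopf.
Variables (K : fieldType) (A : vectType K).

(* The multiplication is part of the data, rather than a ring structure on the
   carrier, so that structures can be put on a given vector space; the zero
   space is allowed. *)
Record hopf_data := HopfData {
  hmul : {bilinear A -> A -> A};
  hone : A;
  hcomul : {linear A -> tensor A A};
  hcounit : {scalar A};
  hantipode : 'End(A) }.

Variable H : hopf_data.
Local Notation "x *h y" := (hmul H x y) (at level 40, left associativity).

(* Sweedler notation: [sw2 x (fun x1 x2 => F)] is the sum of F over
   Delta(x) = x1 ⊗ x2, for F bilinear in (x1, x2); [sw3] is the same for
   (Delta ⊗ id) Delta(x) = x1 ⊗ x2 ⊗ x3. *)
Definition sw2 (W : lmodType K) (x : A) (F : A -> A -> W) : W :=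
  tlift F (hcomul H x).

Definition sw3 (W : lmodType K) (x : A) (F : A -> A -> A -> W) : W :=
  sw2 x (fun y x3 => sw2 y (fun x1 x2 => F x1 x2 x3)).

Definition epsL (x : A) : A := sw2 (hone H) (fun e1 e2 => hcounit H (e1 *h x) *: e2).
Definition epsR (x : A) : A := sw2 (hone H) (fun e1 e2 => hcounit H (x *h e2) *: e1).

(* The inverse of the antipode.  The antipode of a finite-dimensional weak Hopf
   algebra is bijective, so the library's partial inverse is the inverse. *)
Definition antipodeV : 'End(A) := (hantipode H)^-1%VF.

(* The axioms of Boehm, Nill and Szlachanyi; [x1 ⊗ (x2 ⊗ x3)] represents the
   triple tensors. *)
Record weak_hopf : Prop := WeakHopf {
  wh_mulA : associative (hmul H);
  wh_mul1l : left_id (hone H) (hmul H);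
  wh_mul1r : right_id (hone H) (hmul H);
  wh_comulA : forall x,
    sw3 x (fun x1 x2 x3 => x1 ⊗ (x2 ⊗ x3)) =
    sw2 x (fun x1 y => sw2 y (fun x2 x3 => x1 ⊗ (x2 ⊗ x3)));
  wh_counitl : forall x, sw2 x (fun x1 x2 => hcounit H x1 *: x2) = x;
  wh_counitr : forall x, sw2 x (fun x1 x2 => hcounit H x2 *: x1) = x;
  wh_comulM : forall x y, hcomul H (x *h y) =
    sw2 x (fun x1 x2 => sw2 y (fun y1 y2 => (x1 *h y1) ⊗ (x2 *h y2)));
  wh_counitM1 : forall x y z, hcounit H (x *h y *h z) =
    sw2 (W := K^o) y (fun y1 y2 => hcounit H (x *h y1) * hcounit H (y2 *h z));
  wh_counitM2 : forall x y z, hcounit H (x *h y *h z) =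
    sw2 (W := K^o) y (fun y1 y2 => hcounit H (x *h y2) * hcounit H (y1 *h z));
  wh_comul1l : sw3 (hone H) (fun e1 e2 e3 => e1 ⊗ (e2 ⊗ e3)) =
    sw2 (hone H) (fun e1 e2 => sw2 (hone H) (fun f1 f2 =>
      e1 ⊗ ((e2 *h f1) ⊗ f2)));
  wh_comul1r : sw3 (hone H) (fun e1 e2 e3 => e1 ⊗ (e2 ⊗ e3)) =
    sw2 (hone H) (fun e1 e2 => sw2 (hone H) (fun f1 f2 =>
      e1 ⊗ ((f1 *h e2) ⊗ f2)));
  wh_antipodeL : forall x, sw2 x (fun x1 x2 => x1 *h hantipode H x2) = epsL x;
  wh_antipodeR : forall x, sw2 x (fun x1 x2 => hantipode H x1 *h x2) = epsR x;
  wh_antipode3 : forall x,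
    sw3 x (fun x1 x2 x3 => hantipode H x1 *h x2 *h hantipode H x3) =
    hantipode H x }.

End WeakHopf.

Section SkewPairing.
Variables (K : fieldType) (U V : vectType K).
Variables (HU : hopf_data U) (HV : hopf_data V).
Variable p : {bilinear U -> V -> K | *%R & *%R}.

Record skew_pairing : Prop := SkewPairing {
  sp_onel : forall v, p (hone HU) v = hcounit HV v;
  sp_oner : forall u, p u (hone HV) = hcounit HU u;
  sp_mull : forall u u' v, p (hmul HU u u') v =
    sw2 HV (W := K^o) v (fun v1 v2 => p u v1 * p u' v2);
  sp_mulr : forall u v v', p u (hmul HV v v') =
    sw2 HU (W := K^o) u (fun u1 u2 => p u2 v * p u1 v');
  sp_antipode : forall u v, p (hantipode HU u) v = p u (antipodeV HV v) }.

Definition nondegenerate_pairing : Prop :=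
  (forall u, (forall v, p u v = 0) -> u = 0) /\
  (forall v, (forall u, p u v = 0) -> v = 0).

(* [larrow v u] is v ⇀ u and [rarrow u v] is u ↼ v. *)
Definition larrow (v : V) (u : U) : U := sw2 HU u (fun u1 u2 => p u1 v *: u2).
Definition rarrow (u : U) (v : V) : U := sw2 HU u (fun u1 u2 => p u2 v *: u1).

Definition double_rel : set (tensor U V) := [set t |
  (exists u v x, range (epsL HV) x /\
    t = u ⊗ hmul HV x v - hmul HU u (larrow x (hone HU)) ⊗ v) \/
  (exists u v y, range (epsR HV) y /\
    t = u ⊗ hmul HV y v - hmul HU u (rarrow (hone HU) y) ⊗ v)].

Definition double_span : {vspace tensor U V} := lspan double_rel.

Definition drinfeld_double : vectType K := quotv double_span.

Definition dclass (u : U) (v : V) : drinfeld_double := quo double_span (u ⊗ v).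

End SkewPairing.

(* Main.v *)
(* Non-degeneracy makes U a dual of V, so an identity in U or U ⊗ U can be
   checked by pairing with V, where it becomes an identity between products in V.
   With u.(a,b) = Σ p(u1,a) p(u3,b) u2, characterised by
   p(u.(a,b), v) = p(u, b v a), the product of the double reads
   [u ⊗ v][u' ⊗ v'] = Σ [u (u'.(v1, S^-1 v3)) ⊗ v2 v'], with a coproduct on the V
   side only.

   The relations identify V_L with U_L and V_R with U_R, so that u -> [u ⊗ 1] and
   v -> [1 ⊗ v] preserve products and coproducts, [u ⊗ v] = [u ⊗ 1][1 ⊗ v], and
   the coproduct of the unit of the double is the image of that of 1_U and also
   of that of 1_V.  This reduces the weak axioms for unit, counit and antipode to
   those of U and V.

   That the antipode of V is invertible comes from the pairing: the transpose of
   the antipode of U is an antipode for the opposite of V, and antipodes are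
   unique convolution inverses. *)

Require Import Defs.
From HB Require Import structures.
From mathcomp Require Import all_boot all_order all_algebra sesquilinear.
From mathcomp Require Import boolp classical_sets reals.
From mathcomp Require Import complex.

Set Implicit Arguments.
Unset Strict Implicit.
Unset Printing Implicit Defensive.

Import GRing.Theory.
Local Open Scope ring_scope.

(** * Multilinear maps and Sweedler sums *)

(** The pairing turns the coproduct of U into the opposite product of V, so the transpose of [epsL]
    is not [epsL] but the counital map [epsLb] of the opposite algebra, and likewise for [epsR].
    This is why four counital maps are carried along; the antipode links them by
    [S (epsRb x) = epsL x] and [S (epsLb x) = epsR x].

    What makes the quotient workable is that multiplying by an element of V_L changes only the first
    leg of a coproduct, and by an element of V_R only the second. Most computations in the double
    have one shape: a Sweedler leg is replaced by its counital image, a relation carries this image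
    to the other tensor factor, and an antipode or counit identity absorbs it there.

    The counit needs more, since a product v u must be reordered before it can be evaluated. Under
    the counit, outer factors may be replaced by counital images, and non-degeneracy shows that all
    of U_R comes from V_R ([epsR_act]), so that such an image can also be carried from U back to
    V. *)

Section Multilinear.
Variable K : fieldType.
Implicit Types A B C D W : lmodType K.

(** An unbundled predicate, because the maps in question are anonymous functions inside Sweedler
    sums; the tactic [lin] derives their linearity from the syntax. *)
Definition islin A W (f : A -> W) : Prop :=
  forall a x y, f (a *: x + y) = a *: f x + f y.

Definition bil A B W (F : A -> B -> W) : Prop :=
  (forall b, islin (fun a => F a b)) /\ (forall a, islin (fun b => F a b)).

Definition tri A B C W (F : A -> B -> C -> W) : Prop :=
  [/\ forall b c, islin (fun a => F a b c),
      forall a c, islin (fun b => F a b c) &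
      forall a b, islin (fun c => F a b c)].

Lemma islin0 A W (f : A -> W) : islin f -> f 0 = 0.
Proof.
move=> lf; have := lf 1 0 0; rewrite !scale1r add0r => /(congr1 (+%R^~ (- f 0))).
by rewrite subrr addrK.
Qed.

Lemma islinD A W (f : A -> W) : islin f -> {morph f : x y / x + y}.
Proof. by move=> lf x y; have := lf 1 x y; rewrite !scale1r. Qed.

Lemma islinZ A W (f : A -> W) : islin f -> forall a x, f (a *: x) = a *: f x.
Proof. by move=> lf a x; rewrite -[a *: x]addr0 lf (islin0 lf) addr0. Qed.

Lemma islinB A W (f : A -> W) : islin f -> {morph f : x y / x - y}.
Proof. by move=> lf x y; rewrite (islinD lf) -scaleN1r (islinZ lf) scaleN1r. Qed.

Lemma islin_sum A W (f : A -> W) I (r : seq I) (P : pred I) (E : I -> A) :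
  islin f -> f (\sum_(i <- r | P i) E i) = \sum_(i <- r | P i) f (E i).
Proof. by move=> lf; apply: (big_morph _ (islinD lf) (islin0 lf)). Qed.

Lemma islin_id A : islin (fun x : A => x).
Proof. by []. Qed.

Lemma islin_comp A B W (g : B -> W) (f : A -> B) :
  islin g -> islin f -> islin (fun x => g (f x)).
Proof. by move=> lg lf a x y; rewrite lf lg. Qed.

Lemma islin_bundled A W (f : {linear A -> W}) : islin (fun x => f x).
Proof. by move=> a x y; rewrite linearP. Qed.

Lemma islin_scalar A (f : {scalar A}) : islin (W := K^o) (fun x => f x).
Proof. by move=> a x y; rewrite linearP. Qed.

Lemma islin_scalel A W (f : A -> K) (c : W) :
  islin (W := K^o) f -> islin (fun x => f x *: c).
Proof. by move=> lf a x y; rewrite lf scalerDl scalerA. Qed.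

Lemma islin_scaler A W (c : K) (f : A -> W) :
  islin f -> islin (fun x => c *: f x).
Proof. by move=> lf a x y; rewrite lf scalerDr !scalerA mulrC. Qed.

Lemma islin_mulKl A (f : A -> K) (c : K) :
  islin (W := K^o) f -> islin (W := K^o) (fun x => f x * c).
Proof. by move=> lf a x y; rewrite lf mulrDl -mulrA. Qed.

Lemma islin_mulKr A (c : K) (f : A -> K) :
  islin (W := K^o) f -> islin (W := K^o) (fun x => c * f x).
Proof. by move=> lf a x y; rewrite lf mulrDr mulrCA. Qed.

Lemma islin_lfun (A B : vectType K) (f : 'Hom(A, B)) : islin (fun x => f x).
Proof. by move=> a x y; rewrite linearP. Qed.

Lemma bil_bundled A B W (F : {bilinear A -> B -> W}) : bil (fun a b => F a b).
Proof. by split=> [b|a] c x y; rewrite ?linearPl ?linearPr. Qed.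

Lemma bil_form A B (p : {bilinear A -> B -> K | *%R & *%R}) :
  bil (W := K^o) (fun a b => p a b).
Proof. by split=> [b|a] c x y; rewrite ?linearPl ?linearPr. Qed.

Lemma bil_l A B C W (F : B -> C -> W) (f : A -> B) c :
  bil F -> islin f -> islin (fun x => F (f x) c).
Proof. by move=> [lF _] lf a x y; rewrite lf lF. Qed.

Lemma bil_r A B C W (F : C -> B -> W) c (f : A -> B) :
  bil F -> islin f -> islin (fun x => F c (f x)).
Proof. by move=> [_ lF] lf a x y; rewrite lf lF. Qed.

Lemma tri_1 A B C D W (F : B -> C -> D -> W) (f : A -> B) c d :
  tri F -> islin f -> islin (fun x => F (f x) c d).
Proof. by move=> [lF _ _] lf a x y; rewrite lf lF. Qed.

Lemma tri_2 A B C D W (F : C -> B -> D -> W) (f : A -> B) c d :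
  tri F -> islin f -> islin (fun x => F c (f x) d).
Proof. by move=> [_ lF _] lf a x y; rewrite lf lF. Qed.

Lemma tri_3 A B C D W (F : C -> D -> B -> W) (f : A -> B) c d :
  tri F -> islin f -> islin (fun x => F c d (f x)).
Proof. by move=> [_ _ lF] lf a x y; rewrite lf lF. Qed.

End Multilinear.

Arguments bil_l {K A B C W F f} c _ _.
Arguments bil_r {K A B C W F} c {f} _ _.
Arguments tri_1 {K A B C D W F f} c d _ _.
Arguments tri_2 {K A B C D W F f} c d _ _.
Arguments tri_3 {K A B C D W F f} c d _ _.
Arguments islin_scalel {K A W f} c _.
Arguments islin_scaler {K A W} c {f} _.
Arguments islin_mulKl {K A f} c _.
Arguments islin_mulKr {K A} c {f} _.

Section Sweedler.
Variable K : fieldType.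
Implicit Types U V A : vectType K.

Lemma islin_tlift U V (W : lmodType K) (F : U -> V -> W) :
  islin (fun t => tlift F t).
Proof. exact: tlift_linear. Qed.

Lemma islin_tliftF U V (B W : lmodType K) c (F : B -> U -> V -> W) :
  (forall a b, islin (fun x => F x a b)) -> islin (fun x => tlift (F x) c).
Proof.
move=> lF k x y; rewrite /tlift scaler_sumr -big_split /=.
apply: eq_bigr => i _; rewrite scaler_sumr -big_split /=; apply: eq_bigr => j _.
by rewrite lF scalerDr !scalerA mulrC.
Qed.

Lemma tlift_bil U V (W : lmodType K) (F : U -> V -> W) u v :
  bil F -> tlift F (u ⊗ v) = F u v.
Proof.
move=> [lF rF].
have bF : bilinear_for *:%R *:%R F by split=> [v'|u'] a x y; [apply: lF|apply: rF].
pose B : {bilinear U -> V -> W} := HB.pack F (bilinear_isBilinear.Build K U V W _ _ F bF).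
exact: (tlift_tens B).
Qed.

Lemma bil_tens U V : bil (fun (u : U) (v : V) => u ⊗ v).
Proof. exact: (bil_bundled (@tens K U V)). Qed.

Variables (A : vectType K) (H : hopf_data A).

Lemma eq_sw2 (W : lmodType K) x (F G : A -> A -> W) :
  (forall a b, F a b = G a b) -> sw2 H x F = sw2 H x G.
Proof.
by move=> FG; apply: eq_bigr => i _; apply: eq_bigr => j _; rewrite FG.
Qed.

Lemma eq_sw2K x (F G : A -> A -> K) :
  (forall a b, F a b = G a b) ->
  sw2 H (W := K^o) x F = sw2 H (W := K^o) x G :> K.
Proof. exact: (eq_sw2 (W := K^o)). Qed.

Lemma sw2_tens x : sw2 H x (fun a b => a ⊗ b) = hcomul H x.
Proof. exact: tensor_span. Qed.

Lemma sw2_lin (W W' : lmodType K) (f : W -> W') x (F : A -> A -> W) :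
  islin f -> f (sw2 H x F) = sw2 H x (fun a b => f (F a b)).
Proof.
move=> lf; rewrite [LHS]islin_sum //; apply: eq_bigr => i _.
by rewrite islin_sum //; apply: eq_bigr => j _; rewrite islinZ.
Qed.

Lemma sw2_mulKl (c : K) x (F : A -> A -> K) :
  c * sw2 H (W := K^o) x F = sw2 H (W := K^o) x (fun a b => c * F a b).
Proof.
rewrite (sw2_lin (W := K^o) (W' := K^o) (f := fun k => c * k)) //.
by apply: islin_mulKr; apply: islin_id.
Qed.

Lemma sw2_mulKr (c : K) x (F : A -> A -> K) :
  sw2 H (W := K^o) x F * c = sw2 H (W := K^o) x (fun a b => F a b * c).
Proof. by rewrite mulrC sw2_mulKl; apply: eq_sw2 => a b; rewrite mulrC. Qed.

Lemma islin_sw2x (W : lmodType K) (F : A -> A -> W) :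
  islin (fun x => sw2 H x F).
Proof. by move=> a x y; rewrite /sw2 linearP tlift_linear. Qed.

Lemma islin_sw2F (B W : lmodType K) c (F : B -> A -> A -> W) :
  (forall a b, islin (fun x => F x a b)) -> islin (fun x => sw2 H c (F x)).
Proof. exact: islin_tliftF. Qed.

Lemma sw2_def (W : lmodType K) x y (F : A -> A -> W) :
  hcomul H x = y -> sw2 H x F = tlift F y.
Proof. by move=> <-. Qed.

End Sweedler.

Arguments sw2_lin {K A H W W' f x F}.
Arguments eq_sw2 {K A H W x F G}.
Arguments eq_sw2K {K A H x F G}.
Arguments sw2_def {K A H W x y} F.

Lemma sw2_exch (K : fieldType) (A B : vectType K) (H : hopf_data A)
    (H' : hopf_data B) (W : lmodType K) x y (F : A -> A -> B -> B -> W) :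
  sw2 H x (fun a b => sw2 H' y (fun c d => F a b c d)) =
  sw2 H' y (fun c d => sw2 H x (fun a b => F a b c d)).
Proof.
rewrite /sw2 /tlift.
under eq_bigr => i _ do under eq_bigr => j _ do rewrite scaler_sumr.
under eq_bigr => i _ do under eq_bigr => j _ do under eq_bigr => k _ do rewrite scaler_sumr.
under [RHS]eq_bigr => i _ do under eq_bigr => j _ do rewrite scaler_sumr.
under [RHS]eq_bigr => i _ do under eq_bigr => j _ do under eq_bigr => k _ do rewrite scaler_sumr.
under eq_bigr => i _ do rewrite exchange_big /=.
rewrite exchange_big /=; apply: eq_bigr => k _.
under eq_bigr => i _ do under eq_bigr => j _ do under eq_bigr => l _ do rewrite scalerA mulrC -scalerA.
under eq_bigr => i _ do rewrite exchange_big /=.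
by rewrite exchange_big.
Qed.
(** * Weak Hopf algebras *)

(* The counital maps of the algebra opposite to [H]. *)
Definition epsLb (K : fieldType) (A : vectType K) (H : hopf_data A) (x : A) : A :=
  sw2 H (hone H) (fun e f => hcounit H (hmul H x e) *: f).

Definition epsRb (K : fieldType) (A : vectType K) (H : hopf_data A) (x : A) : A :=
  sw2 H (hone H) (fun e f => hcounit H (hmul H f x) *: e).

(* [act u a b] is [a ⇀ u ↼ b]. *)
Definition act (K : fieldType) (U V : vectType K) (HU : hopf_data U)
    (p : {bilinear U -> V -> K | *%R & *%R}) (u : U) (a b : V) : U :=
  sw3 HU u (fun u1 u2 u3 => (p u1 a * p u3 b) *: u2).

(* Ltac patterns do not insert coercions, hence [Bilinear.sort] and the like. *)
Ltac lin_step :=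
  cbv beta;
  match goal with
  | |- forall _, _ => intro
  | |- bil _ => first [assumption | split]
  | |- tri _ => first [assumption | split]
  | |- islin (fun x => x) => apply: islin_id
  | |- @islin _ ?B ?W (fun x => sw2 ?H ?c (@?F x)) =>
      refine (@islin_sw2F _ _ H B W c F _)
  | |- @islin _ ?B ?W (fun x => sw2 ?H (@?f x) ?F) =>
      refine (@islin_comp _ B _ W (fun z => @sw2 _ _ H W z F) f (@islin_sw2x _ _ H W F) _)
  | |- islin (fun x => sw3 _ _ _) => unfold sw3
  | |- islin (fun x => act _ _ _ _ _) => unfold act
  | |- islin (fun x => dclass _ _ _ _ _) => unfold dclass
  | |- islin (fun x => larrow _ _ _ _) => unfold larrow
  | |- islin (fun x => rarrow _ _ _ _) => unfold rarrow
  | |- islin (fun x => epsL _ _) => unfold epsL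
  | |- islin (fun x => epsR _ _) => unfold epsR
  | |- islin (fun x => epsLb _ _) => unfold epsLb
  | |- islin (fun x => epsRb _ _) => unfold epsRb
  | |- islin (fun x => fun_of_lfun ?g (@?f x)) =>
      refine (islin_comp (f := f) (islin_lfun g) _)
  | |- islin (fun x => GRing.Linear.sort ?g (@?f x)) =>
      first [ refine (islin_comp (f := f) (islin_bundled g) _)
            | refine (islin_comp (W := (_ ^o)%type) (f := f) (islin_scalar g) _) ]
  | |- islin (fun x => Bilinear.sort ?p (@?f x) ?c) =>
      first [ refine (bil_l (F := fun a b => p a b) (f := f) c (bil_bundled _) _)
            | refine (bil_l (W := (_ ^o)%type) (F := fun a b => p a b) (f := f) c (bil_form _) _) ]
  | |- islin (fun x => Bilinear.sort ?p ?c (@?f x)) =>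
      first [ refine (bil_r (F := fun a b => p a b) (f := f) c (bil_bundled _) _)
            | refine (bil_r (W := (_ ^o)%type) (F := fun a b => p a b) (f := f) c (bil_form _) _) ]
  | |- islin (fun x => tens (@?f x) ?c) =>
      refine (bil_l (F := fun a b => a ⊗ b) (f := f) c (bil_tens _ _) _)
  | |- islin (fun x => tens ?c (@?f x)) =>
      refine (bil_r (F := fun a b => a ⊗ b) (f := f) c (bil_tens _ _) _)
  | |- islin (fun x => tlift (@?F x) ?c) =>
      refine (@islin_tliftF _ _ _ _ _ c F _)
  | |- islin (fun x => tlift ?F (@?f x)) =>
      refine (islin_comp (f := f) (islin_tlift F) _)
  | |- islin (fun x => (@?f x) *: ?c) => refine (islin_scalel (f := f) c _)
  | |- islin (fun x => ?c *: (@?f x)) => refine (islin_scaler (f := f) c _)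
  | |- islin (fun x => (@?f x) * ?c) => refine (islin_mulKl (f := f) c _)
  | |- islin (fun x => ?c * (@?f x)) => refine (islin_mulKr (f := f) c _)
  | |- islin (tlift _) => apply: islin_tlift
  | h : islin ?g |- islin ?g => exact h
  | h : islin ?g |- islin (fun x => ?g (@?f x)) =>
      refine (islin_comp (g := g) (f := f) h _)
  | h : bil ?F |- islin (fun x => ?F (@?f x) ?c) =>
      refine (bil_l (F := F) (f := f) c h _)
  | h : bil ?F |- islin (fun x => ?F ?c (@?f x)) =>
      refine (bil_r (F := F) (f := f) c h _)
  | h : tri ?F |- islin (fun x => ?F (@?f x) ?c ?d) =>
      refine (tri_1 (F := F) (f := f) c d h _)
  | h : tri ?F |- islin (fun x => ?F ?c (@?f x) ?d) =>
      refine (tri_2 (F := F) (f := f) c d h _)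
  | h : tri ?F |- islin (fun x => ?F ?c ?d (@?f x)) =>
      refine (tri_3 (F := F) (f := f) c d h _)
  end.

Ltac lin := solve [repeat lin_step].

(** The axioms with three legs are identities in an iterated tensor product; applying [G] to them
    yields rules for arbitrary trilinear expressions, such as [sw2_coassoc] and [sw2_sw1l]. *)
Lemma tri_factor (K : fieldType) (U V Z : vectType K) (W : lmodType K)
    (F : U -> V -> Z -> W) : tri F ->
  exists2 G : tensor U (tensor V Z) -> W,
    islin G & forall a b c, G (a ⊗ (b ⊗ c)) = F a b c.
Proof.
move=> tF; exists (fun t => tlift (fun a s => tlift (F a) s) t); first by lin.
move=> a b c; rewrite tlift_bil; last by lin.
by rewrite tlift_bil //; lin.
Qed.

Section WeakHopf.
Variables (K : fieldType) (A : vectType K) (H : hopf_data A).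
Hypothesis wh : weak_hopf H.
Local Notation "x ** y" := (hmul H x y) (at level 40, left associativity).
Local Notation "𝟙" := (hone H).
Local Notation S := (hantipode H).
Local Notation ε := (hcounit H).
Local Notation sw := (sw2 H).
Local Notation PL := (epsL H).
Local Notation PR := (epsR H).

Lemma sw2_coassoc (W : lmodType K) (F : A -> A -> A -> W) x : tri F ->
  sw x (fun y c => sw y (fun a b => F a b c)) =
  sw x (fun a y => sw y (fun b c => F a b c)).
Proof.
move=> tF.
have [G lG GE] := tri_factor tF.
have /(congr1 G) := wh_comulA wh x.
rewrite /sw3 !sw2_lin //.
under eq_sw2 => y c do rewrite sw2_lin //.
under eq_sw2 => y c do under eq_sw2 => a b do rewrite GE.
move->.
under eq_sw2 => y c do rewrite sw2_lin //.
by under eq_sw2 => y c do under eq_sw2 => a b do rewrite GE.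
Qed.

Lemma sw2_counitl (W : lmodType K) (f : A -> W) x : islin f ->
  sw x (fun a b => ε a *: f b) = f x.
Proof.
move=> lf; rewrite -{2}(wh_counitl wh x) sw2_lin //.
by apply: eq_sw2 => a b; rewrite islinZ.
Qed.

Lemma sw2_counitr (W : lmodType K) (f : A -> W) x : islin f ->
  sw x (fun a b => ε b *: f a) = f x.
Proof.
move=> lf; rewrite -{2}(wh_counitr wh x) sw2_lin //.
by apply: eq_sw2 => a b; rewrite islinZ.
Qed.

Lemma sw2_mul (W : lmodType K) (F : A -> A -> W) x y : bil F ->
  sw (x ** y) F =
  sw x (fun a b => sw y (fun c d => F (a ** c) (b ** d))).
Proof.
move=> bF; rewrite (sw2_def F (wh_comulM wh x y)) sw2_lin; last by lin.
apply: eq_sw2 => a b; rewrite sw2_lin; last by lin.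
by apply: eq_sw2 => c d; rewrite tlift_bil.
Qed.

Lemma sw2_1mul (W : lmodType K) (F : A -> A -> W) x : bil F ->
  sw 𝟙 (fun e f => sw x (fun a b => F (e ** a) (f ** b))) = sw x F.
Proof. by move=> bF; rewrite -sw2_mul // wh_mul1l. Qed.

Lemma sw2_mul1 (W : lmodType K) (F : A -> A -> W) x : bil F ->
  sw x (fun a b => sw 𝟙 (fun e f => F (a ** e) (b ** f))) = sw x F.
Proof. by move=> bF; rewrite -sw2_mul // wh_mul1r. Qed.

Lemma sw2_sw1l (W : lmodType K) (F : A -> A -> A -> W) : tri F ->
  sw 𝟙 (fun a y => sw y (fun b c => F a b c)) =
  sw 𝟙 (fun e e' => sw 𝟙 (fun f f' => F e (e' ** f) f')).
Proof.
move=> tF.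
have [G lG GE] := tri_factor tF.
rewrite -sw2_coassoc //.
have /(congr1 G) := wh_comul1l wh.
rewrite /sw3 !sw2_lin //.
under eq_sw2 => y c do rewrite sw2_lin //.
under eq_sw2 => y c do under eq_sw2 => a b do rewrite GE.
move->.
under eq_sw2 => y c do rewrite sw2_lin //.
by under eq_sw2 => y c do under eq_sw2 => a b do rewrite GE.
Qed.

Lemma sw2_sw1r (W : lmodType K) (F : A -> A -> A -> W) : tri F ->
  sw 𝟙 (fun a y => sw y (fun b c => F a b c)) =
  sw 𝟙 (fun e e' => sw 𝟙 (fun f f' => F e (f ** e') f')).
Proof.
move=> tF; have [G lG GE] := tri_factor tF.
rewrite -sw2_coassoc //.
have /(congr1 G) := wh_comul1r wh.
rewrite /sw3 !sw2_lin //.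
under eq_sw2 => y c do rewrite sw2_lin //.
under eq_sw2 => y c do under eq_sw2 => a b do rewrite GE.
move->.
under eq_sw2 => y c do rewrite sw2_lin //.
by under eq_sw2 => y c do under eq_sw2 => a b do rewrite GE.
Qed.

(** * The counit and the counital subalgebras *)

Lemma counit_mul1 x y :
  ε (x ** y) = sw 𝟙 (W := K^o) (fun e f => ε (x ** e) * ε (f ** y)).
Proof. by rewrite -(wh_counitM1 wh) wh_mul1r. Qed.

Lemma counit_mul1' x y :
  ε (x ** y) = sw 𝟙 (W := K^o) (fun e f => ε (x ** f) * ε (e ** y)).
Proof. by rewrite -(wh_counitM2 wh) wh_mul1r. Qed.

Local Notation PLb := (epsLb H).
Local Notation PRb := (epsRb H).

(** Expanding the counital map gives the weak counit axiom with a unit in the middle. The three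
    variants below use the other axiom or the other side. *)
Lemma counit_mul_epsL w x : ε (w ** PL x) = ε (w ** x).
Proof.
rewrite (sw2_lin (W' := K^o) (f := fun z => ε (w ** z))); last by lin.
rewrite [RHS]counit_mul1'; apply: eq_sw2K => e f.
by rewrite linearZr_LR linearZ mulrC.
Qed.

Lemma counit_mul_epsRb w x : ε (w ** PRb x) = ε (w ** x).
Proof.
rewrite (sw2_lin (W' := K^o) (f := fun z => ε (w ** z))); last by lin.
rewrite [RHS]counit_mul1; apply: eq_sw2K => e f.
by rewrite linearZr_LR linearZ mulrC.
Qed.

Lemma counit_epsR_mul w x : ε (PR x ** w) = ε (x ** w).
Proof.
rewrite (sw2_lin (W' := K^o) (f := fun z => ε (z ** w))); last by lin.
by rewrite [RHS]counit_mul1'; apply: eq_sw2K => e f; rewrite linearZl_LR linearZ.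
Qed.

Lemma counit_epsLb_mul w x : ε (PLb x ** w) = ε (x ** w).
Proof.
rewrite (sw2_lin (W' := K^o) (f := fun z => ε (z ** w))); last by lin.
by rewrite [RHS]counit_mul1; apply: eq_sw2K => e f; rewrite linearZl_LR linearZ.
Qed.

(** The counital subalgebra is encoded by fixed points instead of a range; [inL_epsL] shows that the
    two agree. *)
Definition inL z : Prop := PL z = z.
Definition inR y : Prop := PR y = y.

(** Apply φ to the first leg of the threefold coproduct of the unit. The two unit axioms write its
    middle leg as a product in either order, so Δ(z) is both z e ⊗ f and e z ⊗ f, where e ⊗ f is
    Δ(1). *)
Lemma sw2_leg2 (W : lmodType K) (φ : A -> K) (F : A -> A -> W) :
  islin (W := K^o) φ -> bil F ->
  let z := sw 𝟙 (fun e f => φ e *: f) in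
  sw z F = sw 𝟙 (fun e f => F (z ** e) f) /\
  sw z F = sw 𝟙 (fun e f => F (e ** z) f).
Proof.
move=> lφ bF z.
have -> : sw z F = sw 𝟙 (fun a y => sw y (fun b c => φ a *: F b c)).
  rewrite (sw2_lin (f := fun t => sw t F)); last by lin.
  apply: eq_sw2 => e f; rewrite (islinZ (f := fun t => sw t F)); last by lin.
  by rewrite (sw2_lin (f := fun t => φ e *: t)) //; lin.
have tF : tri (fun a b c => φ a *: F b c) by lin.
split; [rewrite sw2_sw1l // | rewrite sw2_sw1r //]; rewrite sw2_exch;
  apply: eq_sw2 => e f.
  rewrite (sw2_lin (f := fun t => F (t ** e) f)); last by lin.
  apply: eq_sw2 => a b; rewrite (islinZ (f := fun t => F (t ** e) f)) //; lin.
rewrite (sw2_lin (f := fun t => F (e ** t) f)); last by lin.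
apply: eq_sw2 => a b; rewrite (islinZ (f := fun t => F (e ** t) f)) //; lin.
Qed.

Lemma sw2_leg1 (W : lmodType K) (φ : A -> K) (F : A -> A -> W) :
  islin (W := K^o) φ -> bil F ->
  let z := sw 𝟙 (fun e f => φ f *: e) in
  sw z F = sw 𝟙 (fun e f => F e (z ** f)) /\
  sw z F = sw 𝟙 (fun e f => F e (f ** z)).
Proof.
move=> lφ bF z.
have tF : tri (fun a b c => φ c *: F a b) by lin.
have -> : sw z F = sw 𝟙 (fun a y => sw y (fun b c => φ c *: F a b)).
  rewrite (sw2_lin (f := fun t => sw t F)); last by lin.
  rewrite -sw2_coassoc //; apply: eq_sw2 => e f; rewrite (islinZ (f := fun t => sw t F));
    last by lin.
  by rewrite (sw2_lin (f := fun t => φ f *: t)) //; lin.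
split; [rewrite sw2_sw1r // | rewrite sw2_sw1l //];
  apply: eq_sw2 => e f.
  rewrite (sw2_lin (f := fun t => F e (t ** f))); last by lin.
  apply: eq_sw2 => a b; rewrite (islinZ (f := fun t => F e (t ** f))) //; lin.
rewrite (sw2_lin (f := fun t => F e (f ** t))); last by lin.
apply: eq_sw2 => a b; rewrite (islinZ (f := fun t => F e (f ** t))) //; lin.
Qed.

(** By [sw2_leg2], the sum defining [epsL z] is (ε ⊗ id) Δ(z). Keeping φ general covers [epsL],
    [epsLb] and, later, the arrows on the unit of U. *)
Lemma inL_leg (φ : A -> K) : islin (W := K^o) φ ->
  inL (sw 𝟙 (fun e f => φ e *: f)).
Proof.
move=> lφ; set z := sw 𝟙 _; rewrite /inL /epsL.
have bF : bil (fun a b : A => ε a *: b) by lin.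
have [_ /= <-] := sw2_leg2 lφ bF; exact: wh_counitl.
Qed.

Lemma inR_leg (φ : A -> K) : islin (W := K^o) φ ->
  inR (sw 𝟙 (fun e f => φ f *: e)).
Proof.
move=> lφ; set z := sw 𝟙 _; rewrite /inR /epsR.
have bF : bil (fun a b : A => ε b *: a) by lin.
have [/= <- _] := sw2_leg1 lφ bF; exact: wh_counitr.
Qed.

Lemma inL_epsL x : inL (PL x). Proof. by apply: inL_leg; lin. Qed.
Lemma inL_epsLb x : inL (PLb x). Proof. by apply: inL_leg; lin. Qed.
Lemma inR_epsR x : inR (PR x). Proof. by apply: inR_leg; lin. Qed.
Lemma inR_epsRb x : inR (PRb x). Proof. by apply: inR_leg; lin. Qed.

Lemma sw2_inL (W : lmodType K) (F : A -> A -> W) z : bil F -> inL z ->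
  sw z F = sw 𝟙 (fun e f => F (z ** e) f).
Proof.
move=> bF <-; have lφ : islin (W := K^o) (fun e => ε (e ** z)) by lin.
by have [+ _] := sw2_leg2 lφ bF.
Qed.

Lemma sw2_inL' (W : lmodType K) (F : A -> A -> W) z : bil F -> inL z ->
  sw z F = sw 𝟙 (fun e f => F (e ** z) f).
Proof.
move=> bF <-; have lφ : islin (W := K^o) (fun e => ε (e ** z)) by lin.
by have [_ +] := sw2_leg2 lφ bF.
Qed.

Lemma sw2_inR (W : lmodType K) (F : A -> A -> W) z : bil F -> inR z ->
  sw z F = sw 𝟙 (fun e f => F e (z ** f)).
Proof.
move=> bF <-; have lφ : islin (W := K^o) (fun e => ε (z ** e)) by lin.
by have [+ _] := sw2_leg1 lφ bF.
Qed.

Lemma sw2_inR' (W : lmodType K) (F : A -> A -> W) z : bil F -> inR z ->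
  sw z F = sw 𝟙 (fun e f => F e (f ** z)).
Proof.
move=> bF <-; have lφ : islin (W := K^o) (fun e => ε (z ** e)) by lin.
by have [_ +] := sw2_leg1 lφ bF.
Qed.

(** Δ(z) is Δ(1) with z multiplied into the first leg, and Δ(x) absorbs Δ(1). *)
Lemma sw2_Lmul (W : lmodType K) (F : A -> A -> W) z x : bil F -> inL z ->
  sw (z ** x) F = sw x (fun a b => F (z ** a) b).
Proof.
move=> bF Lz; rewrite sw2_mul // sw2_inL //; last by lin.
under eq_sw2 => e f do under eq_sw2 => a b do rewrite -(wh_mulA wh).
by rewrite (sw2_1mul (F := fun a b => F (z ** a) b)) //; lin.
Qed.

Lemma sw2_mulL (W : lmodType K) (F : A -> A -> W) z x : bil F -> inL z ->
  sw (x ** z) F = sw x (fun a b => F (a ** z) b).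
Proof.
move=> bF Lz; rewrite sw2_mul // sw2_exch sw2_inL' //; last by lin.
under eq_sw2 => e f do under eq_sw2 => a b do rewrite (wh_mulA wh).
by rewrite sw2_exch (sw2_mul1 (F := fun a b => F (a ** z) b)) //; lin.
Qed.

Lemma sw2_Rmul (W : lmodType K) (F : A -> A -> W) z x : bil F -> inR z ->
  sw (z ** x) F = sw x (fun a b => F a (z ** b)).
Proof.
move=> bF Lz; rewrite sw2_mul // sw2_inR //; last by lin.
under eq_sw2 => e f do under eq_sw2 => a b do rewrite -(wh_mulA wh).
by rewrite (sw2_1mul (F := fun a b => F a (z ** b))) //; lin.
Qed.

Lemma sw2_mulR (W : lmodType K) (F : A -> A -> W) z x : bil F -> inR z ->
  sw (x ** z) F = sw x (fun a b => F a (b ** z)).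
Proof.
move=> bF Lz; rewrite sw2_mul // sw2_exch sw2_inR' //; last by lin.
under eq_sw2 => e f do under eq_sw2 => a b do rewrite (wh_mulA wh).
by rewrite sw2_exch (sw2_mul1 (F := fun a b => F a (b ** z))) //; lin.
Qed.

End WeakHopf.

(** * The antipode and its values on the counital subalgebras *)

Section Antipode.
Variables (K : fieldType) (A : vectType K) (H : hopf_data A).
Hypothesis wh : weak_hopf H.
Local Notation "x ** y" := (hmul H x y) (at level 40, left associativity).
Local Notation "𝟙" := (hone H).
Local Notation S := (hantipode H).
Local Notation ε := (hcounit H).
Local Notation sw := (sw2 H).
Local Notation PL := (epsL H).
Local Notation PR := (epsR H).
Local Notation PLb := (epsLb H).
Local Notation PRb := (epsRb H).
Local Notation inL := (inL H).
Local Notation inR := (inR H).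

(** Contract the outer legs of the threefold coproduct of the unit with ε(· z) and ε(y ·). The two
    unit axioms evaluate the result as z y and as y z. *)
Lemma inLR_comm z y : inL z -> inR y -> z ** y = y ** z.
Proof.
move=> Lz Ry.
pose F a b c := (ε (a ** z) * ε (y ** c)) *: b : A.
have tF : tri F by rewrite /F; lin.
have Fl : z ** y = sw 𝟙 (fun e e' => sw 𝟙 (fun f f' => F e (e' ** f) f')).
  rewrite -{1}Lz -{1}Ry (sw2_lin (f := fun t => t ** PR y)); last by lin.
  apply: eq_sw2 => e e'; rewrite (sw2_lin (f := fun t => (ε (e ** z) *: e') ** t));
    last by lin.
  by apply: eq_sw2 => f f'; rewrite linearZl_LR linearZr_LR /= scalerA.
have Fr : y ** z = sw 𝟙 (fun e e' => sw 𝟙 (fun f f' => F e (f ** e') f')).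
  rewrite -{1}Lz -{1}Ry (sw2_lin (f := fun t => PR y ** t)); last by lin.
  apply: eq_sw2 => e e'; rewrite (sw2_lin (f := fun t => t ** (ε (e ** z) *: e')));
    last by lin.
  by apply: eq_sw2 => f f'; rewrite linearZl_LR linearZr_LR /= scalerA mulrC.
by rewrite Fl Fr -sw2_sw1l // sw2_sw1r.
Qed.

(** Expand [PL] and insert Δ(1) in front of Δ(x). The two copies of Δ(1) merge, by a unit axiom,
    into the threefold coproduct of 1, and regrouping leaves a counit on the second leg of a
    coproduct, which collapses. The next three lemmas vary the side and the order. *)
Lemma sw2_epsL (W : lmodType K) (F : A -> A -> W) x : bil F ->
  sw x (fun a b => F a (PL b)) = sw 𝟙 (fun e f => F (e ** x) f).
Proof.
move=> bF.
transitivity (sw x (fun a b => sw 𝟙 (fun e f => ε (e ** b) *: F a f))).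
  apply: eq_sw2 => a b; rewrite (sw2_lin (f := fun t => F a t)); last by lin.
  by apply: eq_sw2 => e f; rewrite (islinZ (f := fun t => F a t)) //; lin.
rewrite sw2_exch.
transitivity (sw 𝟙 (fun e e' => sw 𝟙 (fun f f' =>
    sw x (fun a b => ε (f ** e' ** b) *: F (e ** a) f')))).
  rewrite [RHS]sw2_exch; apply: eq_sw2 => f f'.
  rewrite -(sw2_1mul wh (F := fun a b => ε (f ** b) *: F a f')); last by lin.
  by apply: eq_sw2 => e e'; apply: eq_sw2 => a b; rewrite (wh_mulA wh).
rewrite -(sw2_sw1r wh (F := fun a b c => sw x (fun a' b' => ε (b ** b') *: F (a ** a') c)));
  last by lin.
rewrite -sw2_coassoc //; last by lin.
apply: eq_sw2 => e f.
rewrite -(sw2_mul wh (F := fun a b => ε b *: F a f)); last by lin.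
by rewrite (sw2_counitr wh (f := fun t => F t f)) //; lin.
Qed.

Lemma sw2_epsLb (W : lmodType K) (F : A -> A -> W) x : bil F ->
  sw x (fun a b => F a (PLb b)) = sw 𝟙 (fun e f => F (x ** e) f).
Proof.
move=> bF.
transitivity (sw x (fun a b => sw 𝟙 (fun e f => ε (b ** e) *: F a f))).
  apply: eq_sw2 => a b; rewrite (sw2_lin (f := fun t => F a t)); last by lin.
  by apply: eq_sw2 => e f; rewrite (islinZ (f := fun t => F a t)) //; lin.
rewrite sw2_exch.
transitivity (sw 𝟙 (fun e e' => sw 𝟙 (fun f f' =>
    sw x (fun a b => ε (b ** (e' ** f)) *: F (a ** e) f')))).
  rewrite [RHS]sw2_exch; apply: eq_sw2 => f f'; rewrite [RHS]sw2_exch.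
  rewrite -(sw2_mul1 wh (F := fun a b => ε (b ** f) *: F a f')); last by lin.
  by apply: eq_sw2 => e e'; apply: eq_sw2 => a b; rewrite (wh_mulA wh).
rewrite -(sw2_sw1l wh (F := fun a b c => sw x (fun a' b' => ε (b' ** b) *: F (a' ** a) c)));
  last by lin.
rewrite -sw2_coassoc //; last by lin.
apply: eq_sw2 => e f; rewrite sw2_exch -(sw2_mul wh (F := fun a b => ε b *: F a f));
  last by lin.
by rewrite (sw2_counitr wh (f := fun t => F t f)) //; lin.
Qed.

Lemma sw2_epsR (W : lmodType K) (F : A -> A -> W) x : bil F ->
  sw x (fun a b => F (PR a) b) = sw 𝟙 (fun e f => F e (x ** f)).
Proof.
move=> bF.
transitivity (sw x (fun a b => sw 𝟙 (fun e f => ε (a ** f) *: F e b))).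
  apply: eq_sw2 => a b; rewrite (sw2_lin (f := fun t => F t b)); last by lin.
  by apply: eq_sw2 => e f; rewrite (islinZ (f := fun t => F t b)) //; lin.
rewrite sw2_exch.
transitivity (sw 𝟙 (fun e e' => sw 𝟙 (fun f f' =>
    sw x (fun a b => ε (a ** (f ** e')) *: F e (b ** f'))))).
  apply: eq_sw2 => e e'; rewrite [RHS]sw2_exch.
  rewrite -(sw2_mul1 wh (F := fun a b => ε (a ** e') *: F e b)); last by lin.
  by apply: eq_sw2 => f f'; apply: eq_sw2 => a b; rewrite (wh_mulA wh).
rewrite -(sw2_sw1r wh (F := fun a b c => sw x (fun a' b' => ε (a' ** b) *: F a (b' ** c))));
  last by lin.
apply: eq_sw2 => e f; rewrite sw2_exch -(sw2_mul wh (F := fun a b => ε a *: F e b));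
  last by lin.
by rewrite (sw2_counitl wh (f := fun t => F e t)) //; lin.
Qed.

Lemma sw2_epsRb (W : lmodType K) (F : A -> A -> W) x : bil F ->
  sw x (fun a b => F (PRb a) b) = sw 𝟙 (fun e f => F e (f ** x)).
Proof.
move=> bF.
transitivity (sw x (fun a b => sw 𝟙 (fun e f => ε (f ** a) *: F e b))).
  apply: eq_sw2 => a b; rewrite (sw2_lin (f := fun t => F t b)); last by lin.
  by apply: eq_sw2 => e f; rewrite (islinZ (f := fun t => F t b)) //; lin.
rewrite sw2_exch.
transitivity (sw 𝟙 (fun e e' => sw 𝟙 (fun f f' =>
    sw x (fun a b => ε (e' ** f ** a) *: F e (f' ** b))))).
  apply: eq_sw2 => e e'.
  rewrite -(sw2_1mul wh (F := fun a b => ε (e' ** a) *: F e b)); last by lin.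
  by apply: eq_sw2 => f f'; apply: eq_sw2 => a b; rewrite (wh_mulA wh).
rewrite -(sw2_sw1l wh (F := fun a b c => sw x (fun a' b' => ε (b ** a') *: F a (c ** b'))));
  last by lin.
apply: eq_sw2 => e f; rewrite -(sw2_mul wh (F := fun a b => ε a *: F e b)); last by lin.
by rewrite (sw2_counitl wh (f := fun t => F e t)) //; lin.
Qed.

Lemma sw2_1L (W : lmodType K) (F : A -> A -> W) : bil F ->
  sw 𝟙 (fun e f => F e (PL f)) = sw 𝟙 F.
Proof.
by move=> bF; rewrite sw2_epsL //; apply: eq_sw2 => e f; rewrite wh_mul1r.
Qed.

Lemma sw2_1R (W : lmodType K) (F : A -> A -> W) : bil F ->
  sw 𝟙 (fun e f => F (PR e) f) = sw 𝟙 F.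
Proof.
by move=> bF; rewrite sw2_epsR //; apply: eq_sw2 => e f; rewrite wh_mul1l.
Qed.

Lemma inL1 : inL 𝟙.
Proof.
rewrite -[inL 𝟙]/(PL 𝟙 = 𝟙) -[RHS](wh_counitl wh); apply: eq_sw2 => e f.
by rewrite wh_mul1r.
Qed.

Lemma inR1 : inR 𝟙.
Proof.
rewrite -[inR 𝟙]/(PR 𝟙 = 𝟙) -[RHS](wh_counitr wh); apply: eq_sw2 => e f.
by rewrite wh_mul1l.
Qed.

Lemma epsL_Lmul z x : inL z -> PL (z ** x) = z ** PL x.
Proof.
move=> Lz; rewrite -!(wh_antipodeL wh) sw2_Lmul //; last by lin.
rewrite (sw2_lin (f := fun t => z ** t)); last by lin.
by apply: eq_sw2 => a b; rewrite (wh_mulA wh).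
Qed.

Lemma epsR_mulR x y : inR y -> PR (x ** y) = PR x ** y.
Proof.
move=> Ry; rewrite -!(wh_antipodeR wh) sw2_mulR //; last by lin.
rewrite (sw2_lin (f := fun t => t ** y)); last by lin.
by apply: eq_sw2 => a b; rewrite (wh_mulA wh).
Qed.

Lemma antipode_epsL x : sw x (fun a b => S a ** PL b) = S x.
Proof.
rewrite -[RHS](wh_antipode3 wh) /sw3 sw2_coassoc //; last by lin.
apply: eq_sw2 => a y; rewrite -(wh_antipodeL wh).
rewrite (sw2_lin (f := fun t => S a ** t)); last by lin.
by apply: eq_sw2 => b c; rewrite (wh_mulA wh).
Qed.

Lemma antipode_epsR x : sw x (fun a b => PR a ** S b) = S x.
Proof.
rewrite -[RHS](wh_antipode3 wh) /sw3.
apply: eq_sw2 => a y; rewrite -(wh_antipodeR wh).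
by rewrite (sw2_lin (f := fun t => t ** S y)); last by lin.
Qed.

(** With Δ(y) = e ⊗ f y and [f] taken in the left subalgebra, S(e) PL(f y) becomes S(e) f PL(y), and
    the sum of S(e) f is PR(1) = 1. *)
Lemma antipode_inR y : inR y -> S y = PL y.
Proof.
move=> Ry; rewrite -[LHS]antipode_epsL sw2_inR' //; last by lin.
rewrite -(sw2_1L (F := fun e f => S e ** PL (f ** y))); last by lin.
transitivity (sw 𝟙 (fun e f => S e ** PL f ** PL y)).
  apply: eq_sw2 => e f; rewrite epsL_Lmul ?(wh_mulA wh) //.
  exact: inL_epsL.
rewrite (sw2_1L (F := fun e f => S e ** f ** PL y)); last by lin.
rewrite -(sw2_lin (f := fun t => t ** PL y)); last by lin.
by rewrite (wh_antipodeR wh) inR1 wh_mul1l.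
Qed.

Lemma antipode_inL z : inL z -> S z = PR z.
Proof.
move=> Lz; rewrite -[LHS]antipode_epsR sw2_inL //; last by lin.
rewrite -(sw2_1R (F := fun e f => PR (z ** e) ** S f)); last by lin.
transitivity (sw 𝟙 (fun e f => PR z ** (PR e ** S f))).
  apply: eq_sw2 => e f; rewrite epsR_mulR ?(wh_mulA wh) //.
  exact: inR_epsR.
rewrite (sw2_1R (F := fun e f => PR z ** (e ** S f))); last by lin.
rewrite -(sw2_lin (f := fun t => PR z ** t)); last by lin.
by rewrite (wh_antipodeL wh) inL1 wh_mul1r.
Qed.

Lemma inL_antipode y : inR y -> inL (S y).
Proof. by move=> /antipode_inR ->; apply: inL_epsL. Qed.

Lemma inR_antipode z : inL z -> inR (S z).
Proof. by move=> /antipode_inL ->; apply: inR_epsR. Qed.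

Lemma epsL_mul_epsRb w x : PL (w ** PRb x) = PL (w ** x).
Proof.
apply: eq_sw2 => e f; rewrite !(wh_mulA wh).
by rewrite (counit_mul_epsRb wh).
Qed.

Lemma epsR_epsLb_mul w x : PR (PLb x ** w) = PR (x ** w).
Proof.
apply: eq_sw2 => e f; rewrite -!(wh_mulA wh).
by rewrite (counit_epsLb_mul wh).
Qed.

Lemma epsL_mul_epsL w x : PL (w ** PL x) = PL (w ** x).
Proof.
apply: eq_sw2 => e f; rewrite !(wh_mulA wh).
by rewrite (counit_mul_epsL wh).
Qed.

Lemma epsR_epsR_mul w x : PR (PR x ** w) = PR (x ** w).
Proof.
apply: eq_sw2 => e f; rewrite -!(wh_mulA wh).
by rewrite (counit_epsR_mul wh).
Qed.

(** Once [S] is invertible, this and [antipode_epsLb] compute its inverse on the two counital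
    subalgebras. *)
Lemma antipode_epsRb x : S (PRb x) = PL x.
Proof.
rewrite antipode_inR; last exact: inR_epsRb.
by have := epsL_mul_epsRb 𝟙 x; rewrite !(wh_mul1l wh).
Qed.

Lemma antipode_epsLb x : S (PLb x) = PR x.
Proof.
rewrite antipode_inL; last exact: inL_epsLb.
by have := epsR_epsLb_mul 𝟙 x; rewrite !(wh_mul1r wh).
Qed.

Lemma antipode1 : S 𝟙 = 𝟙.
Proof. by rewrite antipode_inR ?inL1 //; apply: inR1. Qed.

(* Both [x, y |-> S (x y)] and [x, y |-> S y S x] are convolution inverse to the
   product, with the same idempotents [PR (x y)] and [PL (x y)]. *)
Lemma antipodeM x y : S (x ** y) = S y ** S x.
Proof.
transitivity (sw x (fun a s => sw y (fun p t => S p ** S a ** PL (s ** t)))).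
  rewrite -[LHS]antipode_epsR sw2_mul //; last by lin.
  transitivity (sw x (fun s b => sw s (fun a m =>
      sw y (fun p t => sw t (fun q d => S p ** S a ** (m ** q ** S (b ** d))))))).
    apply: eq_sw2 => s b; rewrite [RHS]sw2_exch.
    have -> : sw y (fun p t => sw s (fun a m => sw t (fun q d => S p ** S a ** (m ** q ** S (b ** d))))) =
        sw y (fun p t => sw t (fun q d => S p ** PR s ** q ** S (b ** d))).
      apply: eq_sw2 => p t; rewrite sw2_exch; apply: eq_sw2 => q d.
      rewrite -(wh_antipodeR wh s).
      rewrite [RHS](sw2_lin (f := fun t => S p ** t ** q ** S (b ** d))); last by lin.
      by apply: eq_sw2 => a m; rewrite !(wh_mulA wh).
    rewrite -sw2_coassoc //; last by lin.
    (* [PR (s c)] depends on [s] only through [PR s], which enters the second leg of the coproduct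
       alone; hence [PR (s c)] is the sum of S(c1) PR(s) c2. *)
    apply: eq_sw2 => c d; rewrite -epsR_epsR_mul -(wh_antipodeR wh).
    rewrite sw2_Rmul //; [|by lin|exact: inR_epsR].
    rewrite (sw2_lin (f := fun t => t ** S (b ** d))); last by lin.
    by apply: eq_sw2 => p q; rewrite !(wh_mulA wh).
  rewrite sw2_coassoc //; last by lin.
  apply: eq_sw2 => a s; rewrite sw2_exch; apply: eq_sw2 => p t.
  rewrite -(wh_antipodeL wh) (sw2_lin (f := fun z => S p ** S a ** z)); last by lin.
  by rewrite sw2_mul //; lin.
transitivity (sw x (fun s n => sw y (fun p t => S p ** PR s ** PL t ** S n))).
  transitivity (sw x (fun a s => sw s (fun m n =>
      sw y (fun p t => S p ** S a ** m ** PL t ** S n)))).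
    apply: eq_sw2 => a s; rewrite sw2_exch; apply: eq_sw2 => p t.
    rewrite -epsL_mul_epsL -(wh_antipodeL wh) sw2_mulL; [|by []|by lin|exact: inL_epsL].
    rewrite (sw2_lin (f := fun z => S p ** S a ** z)); last by lin.
    by apply: eq_sw2 => m n; rewrite !(wh_mulA wh).
  rewrite -sw2_coassoc //; last by lin.
  apply: eq_sw2 => s n; rewrite sw2_exch; apply: eq_sw2 => p t.
  rewrite -(wh_antipodeR wh) (sw2_lin (f := fun z => S p ** z ** PL t ** S n)); last by lin.
  by apply: eq_sw2 => m m'; rewrite !(wh_mulA wh).
(* The middle factors [PR s] and [PL t] commute; after the swap each is absorbed by the antipode
   next to it. *)
rewrite -[S y]antipode_epsL -[S x]antipode_epsR sw2_exch.
rewrite [RHS](sw2_lin (f := fun z => z ** _)); last by lin.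
apply: eq_sw2 => p t; rewrite [RHS](sw2_lin (f := fun z => S p ** PL t ** z)); last by lin.
apply: eq_sw2 => a b; rewrite -!(wh_mulA wh); congr (_ ** _).
by rewrite !(wh_mulA wh) (inLR_comm (z := PL t) (y := PR a)) //; [apply: inL_epsL|apply: inR_epsR].
Qed.

End Antipode.
(** A form that separates the points of A also separates those of A ⊗ A: the independence of the
    basis is used once for each leg of the difference. *)
Lemma tens_ext (K : fieldType) (A B : vectType K) (q : A -> B -> K)
    (t t' : tensor A A) :
  (forall y, islin (W := K^o) (fun x => q x y)) ->
  (forall x, (forall y, q x y = 0) -> x = 0) ->
  (forall y y', tlift (W := K^o) (fun a b => q a y * q b y') t =
                tlift (W := K^o) (fun a b => q a y * q b y') t') ->
  t = t'.
Proof.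
move=> lq q0 tt'; apply/eqP; rewrite -subr_eq0; apply/eqP.
have {tt'} : forall y y', tlift (W := K^o) (fun a b => q a y * q b y') (t - t') = 0.
  by move=> y y'; rewrite islinB ?tt' ?subrr //; apply: islin_tlift.
move: (t - t') => {t'} {}t t0.
have /freeP fr := basis_free (vbasisP {:A}).
apply/matrixP => i j; rewrite mxE.
apply: (fr (fun j => (t : 'M_(_, _)) i j)); apply: (q0 _) => y'.
rewrite (islin_sum (W := K^o) (f := fun x => q x y') _ _ _ (lq y')).
pose c i := \sum_j (t : 'M_(_, _)) i j * q (vbasis {:A})`_j y'.
transitivity (c i); first by apply: eq_bigr => k _; rewrite (islinZ (W := K^o) (lq y')).
apply: (fr c); apply: (q0 _) => y; rewrite -[RHS](t0 y y') (islin_sum (W := K^o) (f := fun x => q x y) _ _ _ (lq y)).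
apply: eq_bigr => k _; rewrite (islinZ (W := K^o) (lq y)) /c /= scaler_suml.
apply: eq_bigr => l _.
by rewrite -[LHS]/(_ * _ * _) -[RHS]/(_ * (_ * _)) -mulrA [q _ y * _]mulrC.
Qed.

Section CounitalMaps.
Variables (K : fieldType) (A : vectType K) (H : hopf_data A).
Hypothesis wh : weak_hopf H.
Local Notation "x ** y" := (hmul H x y) (at level 40, left associativity).
Local Notation "𝟙" := (hone H).
Local Notation ε := (hcounit H).
Local Notation sw := (sw2 H).

Lemma mul_epsR x : sw x (fun a b => a ** epsR H b) = x.
Proof.
rewrite -[RHS](wh_counitr wh) -(sw2_mul1 wh (F := fun a b => ε b *: a)); last by lin.
apply: eq_sw2 => a b; rewrite (sw2_lin (f := fun t => a ** t)); last by lin.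
by apply: eq_sw2 => e f; rewrite linearZr_LR.
Qed.

Lemma epsL_mul x : sw x (fun a b => epsL H a ** b) = x.
Proof.
rewrite -[RHS](wh_counitl wh) -(sw2_1mul wh (F := fun a b => ε a *: b)); last by lin.
rewrite sw2_exch.
apply: eq_sw2 => a b; rewrite (sw2_lin (f := fun t => t ** b)); last by lin.
by apply: eq_sw2 => e f; rewrite linearZl_LR.
Qed.

Lemma epsRb_mul x : sw x (fun a b => epsRb H b ** a) = x.
Proof.
rewrite -[RHS](wh_counitr wh) -(sw2_1mul wh (F := fun a b => ε b *: a)); last by lin.
rewrite sw2_exch.
apply: eq_sw2 => a b; rewrite (sw2_lin (f := fun t => t ** a)); last by lin.
by apply: eq_sw2 => e f; rewrite linearZl_LR.
Qed.

End CounitalMaps.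

(** * The quotient space *)

Section Quotient.
Variables (K : fieldType) (A : vectType K) (J : {vspace A}).

Lemma quo_vsval (d : quotv J) : quo J (vsval d) = d.
Proof.
apply: val_inj; rewrite /= quoE daddv_pi_id ?subvsP //.
by rewrite capvC capv_compl.
Qed.

(** A class is represented by a chosen vector that differs from [t] by an element of [J]; this is
    how linear maps descend to the quotient. *)
Lemma vsval_quo (W : lmodType K) (f : A -> W) t : islin f ->
  (forall s, s \in J -> f s = 0) -> f (vsval (quo J t)) = f t.
Proof.
move=> lf f0; apply/eqP; rewrite -subr_eq0 -islinB //; apply/eqP/f0.
have : vsval (quo J t) - t \in lker (quo J).
  by rewrite memv_ker linearB /= quo_vsval subrr.
by rewrite lker_quo.
Qed.

End Quotient.

Lemma islin_vsval (K : fieldType) (A : vectType K) (J : {vspace A}) :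
  islin (fun d : subvs_of J => vsval d).
Proof. by move=> a x y; rewrite linearP. Qed.

(** Five legs appear when the action on a product in U is distributed. On the right, the outer pair
    [a], [e] acts on the first factor, and the inner triple [b], [c], [d] is nested as in the
    product of the double. *)
Lemma sw2_regroup (K : fieldType) (A : vectType K) (H : hopf_data A)
    (W : lmodType K) (G : A -> A -> A -> A -> A -> W) x :
  weak_hopf H ->
  (forall b c d e, islin (fun a => G a b c d e)) ->
  (forall a c d e, islin (fun b => G a b c d e)) ->
  (forall a b d e, islin (fun c => G a b c d e)) ->
  (forall a b c e, islin (fun d => G a b c d e)) ->
  (forall a b c d, islin (fun e => G a b c d e)) ->
  sw2 H x (fun y1 y => sw2 H y (fun y2 y3 =>
    sw2 H y1 (fun a b => sw2 H y3 (fun d e => G a b y2 d e)))) =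
  sw2 H x (fun a y => sw2 H y (fun t e =>
    sw2 H t (fun b z => sw2 H z (fun c d => G a b c d e)))).
Proof.
move=> wh l1 l2 l3 l4 l5.
transitivity (sw2 H x (fun y1 y => sw2 H y1 (fun a b => sw2 H y (fun y2 y3 =>
    sw2 H y3 (fun d e => G a b y2 d e))))).
  by apply: eq_sw2 => y1 y; rewrite sw2_exch.
rewrite sw2_coassoc //; last by split=> *; repeat (lin_step || (apply: islin_comp => //)).
apply: eq_sw2 => a s.
rewrite (sw2_coassoc wh (F := fun b z e => sw2 H z (fun c d => G a b c d e)));
  last by split=> *; repeat (lin_step || (apply: islin_comp => //)).
apply: eq_sw2 => b y.
by rewrite sw2_coassoc.
Qed.

(** * The pairing *)

Section Pairing.
Variables (K : fieldType) (U V : vectType K).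
Variables (HU : hopf_data U) (HV : hopf_data V).
Variable p : {bilinear U -> V -> K | *%R & *%R}.
Hypotheses (whU : weak_hopf HU) (whV : weak_hopf HV).
Hypotheses (sp : skew_pairing HU HV p) (nd : nondegenerate_pairing p).
Local Notation "x *u y" := (hmul HU x y) (at level 40, left associativity).
Local Notation "x *v y" := (hmul HV x y) (at level 40, left associativity).
Local Notation "1u" := (hone HU).
Local Notation "1v" := (hone HV).
Local Notation Su := (hantipode HU).
Local Notation Sv := (hantipode HV).
Local Notation Si := (antipodeV HV).
Local Notation swU := (sw2 HU).
Local Notation swV := (sw2 HV).
Local Notation act := (act HU p).

Lemma pair_extl u u' : (forall v, p u v = p u' v) -> u = u'.
Proof.
move=> uu'; apply/eqP; rewrite -subr_eq0; apply/eqP; apply: (nd.1) => v.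
by rewrite linearBl uu' subrr.
Qed.

Lemma pair_extr v v' : (forall u, p u v = p u v') -> v = v'.
Proof.
move=> vv'; apply/eqP; rewrite -subr_eq0; apply/eqP; apply: (nd.2) => u.
by rewrite linearBr vv' subrr.
Qed.

Lemma pair_swl (A : vectType K) (H : hopf_data A) x F v :
  p (sw2 H x F) v = sw2 H (W := K^o) x (fun a b => p (F a b) v).
Proof. by rewrite (sw2_lin (W' := K^o) (f := fun t => p t v)) //; lin. Qed.

Lemma pair_swr (A : vectType K) (H : hopf_data A) x F u :
  p u (sw2 H x F) = sw2 H (W := K^o) x (fun a b => p u (F a b)).
Proof. by rewrite (sw2_lin (W' := K^o) (f := fun t => p u t)) //; lin. Qed.

Lemma pairZl c u v : p (c *: u) v = c * p u v.
Proof. exact: linearZl_LR. Qed.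

Lemma pairZr c u v : p u (c *: v) = c * p u v.
Proof. exact: linearZr_LR. Qed.

Lemma pair_sw1 v v' :
  swU (W := K^o) 1u (fun e f => p e v * p f v') = hcounit HV (v' *v v) :> K.
Proof.
by rewrite -(sp_onel sp) (sp_mulr sp); apply: eq_sw2K => e f; rewrite mulrC.
Qed.

(** The counit of U is the pairing with [1v], so a sum over Δ(1_V) can be brought in and the one
    over Δ(1_U) evaluated by [pair_sw1]. The reversed order in [sp_mulr] is what produces
    [epsLb]. *)
Lemma pair_epsL u v : p (epsL HU u) v = p u (epsLb HV v).
Proof.
rewrite pair_swl pair_swr.
transitivity (swU (W := K^o) 1u (fun e f => swV (W := K^o) 1v (fun a b =>
    p e a * p f v * p u b))).
  apply: eq_sw2K => e f; rewrite pairZl -(sp_oner sp) (sp_mull sp) sw2_mulKr.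
  by apply: eq_sw2K => a b; rewrite mulrAC.
rewrite sw2_exch; apply: eq_sw2K => a b.
by rewrite -sw2_mulKr pair_sw1 pairZr.
Qed.

Lemma pair_epsR u v : p (epsR HU u) v = p u (epsRb HV v).
Proof.
rewrite pair_swl pair_swr.
transitivity (swU (W := K^o) 1u (fun e f => swV (W := K^o) 1v (fun a b =>
    p e v * p f b * p u a))).
  apply: eq_sw2K => e f; rewrite pairZl -(sp_oner sp) (sp_mull sp) sw2_mulKr.
  by apply: eq_sw2K => a b; rewrite mulrC [p u a * _]mulrC mulrA.
rewrite sw2_exch; apply: eq_sw2K => a b.
by rewrite -sw2_mulKr pair_sw1 pairZr.
Qed.

Lemma pair_antipodeV_mul x u :
  p u (swV x (fun a b => Si b *v a)) =
  p (swU u (fun a b => a *u Su b)) x.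
Proof.
rewrite pair_swl pair_swr.
under [RHS]eq_sw2K => a b do rewrite (sp_mull sp).
rewrite sw2_exch; apply: eq_sw2K => a b; rewrite (sp_mulr sp).
by apply: eq_sw2K => c d; rewrite (sp_antipode sp) mulrC.
Qed.

(** The transpose of an antipode axiom of U; it does not presuppose that [Si] inverts [Sv]. *)
Lemma antipodeV_mul x : swV x (fun a b => Si b *v a) = epsLb HV x.
Proof.
apply: pair_extr => u.
by rewrite pair_antipodeV_mul (wh_antipodeL whU) pair_epsL.
Qed.

Lemma mul_antipodeV x : swV x (fun a b => b *v Si a) = epsRb HV x.
Proof.
apply: pair_extr => u; rewrite -pair_epsR -(wh_antipodeR whU).
rewrite pair_swl pair_swr.
under [RHS]eq_sw2K => a b do rewrite (sp_mull sp).
rewrite sw2_exch; apply: eq_sw2K => a b; rewrite (sp_mulr sp).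
by apply: eq_sw2K => c d; rewrite (sp_antipode sp) mulrC.
Qed.

Lemma antipodeV_epsLb x : swV x (fun a y => epsLb HV y *v Si a) = Si x.
Proof.
apply: pair_extr => u; rewrite -(sp_antipode sp) -(antipode_epsL whU).
rewrite pair_swl pair_swr.
under [RHS]eq_sw2K => a b do rewrite (sp_mull sp).
rewrite sw2_exch; apply: eq_sw2K => a b; rewrite (sp_mulr sp).
by apply: eq_sw2K => c d; rewrite (sp_antipode sp) pair_epsL mulrC.
Qed.

(* [Si] is a priori only the library's partial inverse.  By [antipodeM],
   [x |-> Sv (Si x)] is a convolution inverse of [Sv], as is the identity. *)
Lemma antipodeVK x : Sv (Si x) = x.
Proof.
have SSi y : swV y (fun a b => Sv a *v Sv (Si b)) = epsR HV y.
  rewrite -(antipode_epsLb whV) -antipodeV_mul (sw2_lin (f := fun z => Sv z)); last by lin.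
  by apply: eq_sw2 => a b; rewrite (antipodeM whV).
have SiS y : swV y (fun a b => Sv (Si a) *v Sv b) = epsL HV y.
  rewrite -(antipode_epsRb whV) -mul_antipodeV (sw2_lin (f := fun z => Sv z)); last by lin.
  by apply: eq_sw2 => a b; rewrite (antipodeM whV).
transitivity (swV x (fun a y => Sv (Si a) *v epsR HV y)).
  rewrite -antipodeV_epsLb (sw2_lin (f := fun z => Sv z)); last by lin.
  by apply: eq_sw2 => a b; rewrite (antipodeM whV) (antipode_epsLb whV).
transitivity (swV x (fun y c => epsL HV y *v Sv (Si c))).
  transitivity (swV x (fun a y => swV y (fun b c => Sv (Si a) *v Sv b *v Sv (Si c)))).
    apply: eq_sw2 => a y; rewrite -SSi (sw2_lin (f := fun t => Sv (Si a) *v t)); last by lin.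
    by apply: eq_sw2 => b c; rewrite (wh_mulA whV).
  rewrite -sw2_coassoc //; last by lin.
  apply: eq_sw2 => y c; rewrite -SiS.
  by rewrite (sw2_lin (f := fun t => t *v Sv (Si c))) //; lin.
transitivity (swV x (fun a y => swV y (fun b c => a *v Sv b *v Sv (Si c)))).
  rewrite -sw2_coassoc //; last by lin.
  apply: eq_sw2 => y c; rewrite -(wh_antipodeL whV).
  by rewrite (sw2_lin (f := fun t => t *v Sv (Si c))) //; lin.
rewrite -[RHS](mul_epsR whV); apply: eq_sw2 => a y.
rewrite -SSi (sw2_lin (f := fun t => a *v t)); last by lin.
by apply: eq_sw2 => b c; rewrite (wh_mulA whV).
Qed.

(** [antipodeVK] makes [Sv] surjective; by rank-nullity its kernel is zero, and then the partial
    inverse is a left inverse. *)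
Lemma antipodeKV x : Si (Sv x) = x.
Proof.
rewrite /antipodeV lker0_lfunK //.
have /eqP dS : (limg Sv == fullv)%VS.
  rewrite eqEsubv subvf; apply/subvP => y _.
  by rewrite -[y]antipodeVK memv_img ?memvf.
have := limg_ker_dim Sv fullv; rewrite dS capfv => /eqP.
by rewrite -[X in _ == X]add0n eqn_add2r dimv_eq0.
Qed.

Lemma antipodeVM x y : Si (x *v y) = Si y *v Si x.
Proof.
by rewrite -[RHS]antipodeKV (antipodeM whV) !antipodeVK.
Qed.

(** Paired with two elements of U, this is the antimultiplicativity of the antipode of U. *)
Lemma sw2_antipodeV (W : lmodType K) (F : V -> V -> W) v : bil F ->
  swV (Si v) F = swV v (fun a b => F (Si b) (Si a)).
Proof.
move=> bF; suff E : hcomul HV (Si v) = swV v (fun a b => Si b ⊗ Si a).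
  rewrite (sw2_def F E) (sw2_lin (f := fun t => tlift F t)); last by lin.
  by apply: eq_sw2 => a b; rewrite tlift_bil.
apply: (tens_ext (q := fun v u => p u v)) => [u|v0 |u u']; [by lin|exact: nd.2|].
rewrite -/(swV (W := K^o) _ _).
transitivity (p (u *u u') (Si v)).
  by rewrite (sp_mull sp).
rewrite -(sp_antipode sp) (antipodeM whU) (sp_mull sp).
rewrite (sw2_lin (W' := K^o) (f := fun t => tlift (W := K^o) _ t)); last exact: islin_tlift.
apply: (eq_sw2 (W := K^o)) => a b; rewrite (tlift_bil (W := K^o)); last by lin.
by rewrite !(sp_antipode sp) mulrC.
Qed.

Lemma sw2_antipode (W : lmodType K) (F : V -> V -> W) v : bil F ->
  swV (Sv v) F = swV v (fun a b => F (Sv b) (Sv a)).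
Proof.
move=> bF; rewrite -[in RHS](antipodeKV v) sw2_antipodeV; last by lin.
by apply: eq_sw2 => a b; rewrite !antipodeVK.
Qed.

Lemma antipodeV_inL z : inL HV z -> Si z = epsRb HV z.
Proof. by move=> Lz; rewrite -[RHS]antipodeKV (antipode_epsRb whV) Lz. Qed.

Lemma antipodeV_inR y : inR HV y -> Si y = epsLb HV y.
Proof. by move=> Ry; rewrite -[RHS]antipodeKV (antipode_epsLb whV) Ry. Qed.

Lemma inR_antipodeV z : inL HV z -> inR HV (Si z).
Proof. by move=> /antipodeV_inL->; apply: inR_epsRb. Qed.

Lemma inL_antipodeV y : inR HV y -> inL HV (Si y).
Proof. by move=> /antipodeV_inR->; apply: inL_epsLb. Qed.

Lemma epsR_antipodeV v : epsR HV (Si v) = epsRb HV v.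
Proof.
rewrite -(wh_antipodeR whV) sw2_antipodeV; last by lin.
by rewrite -mul_antipodeV; apply: eq_sw2 => a b; rewrite antipodeVK.
Qed.

(** * The action of V on U *)

Lemma pair_act u a b v : p (act u a b) v = p u (b *v v *v a).
Proof.
rewrite /act /sw3 sw2_coassoc; [|by []|by lin].
rewrite (sp_mulr sp) pair_swl; apply: eq_sw2K => u1 y.
rewrite pair_swl (sp_mulr sp) sw2_mulKr; apply: eq_sw2K => u2 u3.
by rewrite pairZl mulrAC mulrC [p u1 a * _]mulrC mulrA.
Qed.

Lemma act_act u a b a' b' :
  act (act u a b) a' b' = act u (a' *v a) (b *v b').
Proof.
by apply: pair_extl => v; rewrite !pair_act !(wh_mulA whV).
Qed.

Lemma act11 u : act u 1v 1v = u.
Proof.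
by apply: pair_extl => v; rewrite pair_act (wh_mul1l whV) (wh_mul1r whV).
Qed.

Lemma act_mul u w a b : act (u *u w) a b =
  swV a (fun a1 a2 => swV b (fun b1 b2 => act u a1 b1 *u act w a2 b2)).
Proof.
apply: pair_extl => v; rewrite pair_act (sp_mull sp).
rewrite (sw2_mul whV (W := K^o)); last by lin.
rewrite sw2_exch pair_swl; apply: eq_sw2K => a1 a2.
rewrite (sw2_mul whV (W := K^o)); last by lin.
rewrite pair_swl; apply: eq_sw2K => b1 b2.
by rewrite (sp_mull sp); apply: eq_sw2K => v1 v2; rewrite !pair_act.
Qed.

Lemma pair_counitl u v :
  p u v = swV (W := K^o) v (fun a b => hcounit HV a * p u b).
Proof.
symmetry; apply: (sw2_counitl whV (W := K^o) (f := fun t => p u t)); lin.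
Qed.

Lemma pair_counitr u v :
  p u v = swV (W := K^o) v (fun a b => p u a * hcounit HV b).
Proof.
transitivity (swV (W := K^o) v (fun a b => hcounit HV b *: (p u a : K^o))).
  symmetry; apply: (sw2_counitr whV (W := K^o) (f := fun t => p u t)); lin.
by apply: eq_sw2K => a b; rewrite mulrC.
Qed.

Lemma pair_act1 a b v : p (act 1u a b) v = hcounit HV (b *v v *v a).
Proof. by rewrite pair_act (sp_onel sp). Qed.

(** The first leg of a coproduct in V pairs with the left factor of a product in U. Elements of V_L
    touch only that leg, so they act by left multiplication; elements of V_R act by right
    multiplication. *)
Lemma act_inLl z u : inL HV z -> act u z 1v = act 1u z 1v *u u.
Proof.
move=> Lz; apply: pair_extl => v; rewrite pair_act (wh_mul1l whV) (sp_mull sp).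
rewrite pair_counitl sw2_mulL //; last by lin.
by apply: eq_sw2K => a b; rewrite pair_act1 (wh_mul1l whV).
Qed.

Lemma act_inLr z u : inL HV z -> act u 1v z = act 1u 1v z *u u.
Proof.
move=> Lz; apply: pair_extl => v; rewrite pair_act (wh_mul1r whV) (sp_mull sp).
rewrite pair_counitl sw2_Lmul //; last by lin.
by apply: eq_sw2K => a b; rewrite pair_act1 (wh_mul1r whV).
Qed.

Lemma act_inRl y u : inR HV y -> act u y 1v = u *u act 1u y 1v.
Proof.
move=> Ry; apply: pair_extl => v; rewrite pair_act (wh_mul1l whV) (sp_mull sp).
rewrite pair_counitr sw2_mulR //; last by lin.
by apply: eq_sw2K => a b; rewrite pair_act1 (wh_mul1l whV).
Qed.

Lemma act_inRr y u : inR HV y -> act u 1v y = u *u act 1u 1v y.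
Proof.
move=> Ry; apply: pair_extl => v; rewrite pair_act (wh_mul1r whV) (sp_mull sp).
rewrite pair_counitr sw2_Rmul //; last by lin.
by apply: eq_sw2K => a b; rewrite pair_act1 (wh_mul1r whV).
Qed.

(** The second weak counit axiom, transposed. It separates an action on the unit into a factor of
    U_L and one of U_R, each of which a relation can carry to V. *)
Lemma act1_split a b : act 1u a b = act 1u a 1v *u act 1u 1v b.
Proof.
apply: pair_extl => v; rewrite pair_act1 (sp_mull sp) (wh_counitM2 whV).
by apply: eq_sw2K => v1 v2; rewrite !pair_act1 (wh_mul1l whV) (wh_mul1r whV) mulrC.
Qed.

Lemma act1_epsL a b : act 1u (epsL HV a) b = act 1u a b.
Proof.
by apply: pair_extl => v; rewrite !pair_act1 counit_mul_epsL.
Qed.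

Lemma act1_epsR a b : act 1u a (epsR HV b) = act 1u a b.
Proof.
apply: pair_extl => v; rewrite !pair_act1 -!(wh_mulA whV).
by rewrite counit_epsR_mul.
Qed.

Lemma act1_antipodeV_inL z b : inL HV z -> act 1u (Si z) b = act 1u z b.
Proof.
move=> Lz; apply: pair_extl => v; rewrite !pair_act1 antipodeV_inL //.
by rewrite counit_mul_epsRb.
Qed.

Lemma act1_antipodeV_inR a y : inR HV y -> act 1u a (Si y) = act 1u a y.
Proof.
move=> Ry; apply: pair_extl => v; rewrite !pair_act1 antipodeV_inR //.
by rewrite -!(wh_mulA whV) counit_epsLb_mul.
Qed.

Lemma larrowE v u : larrow HU p v u = act u v 1v.
Proof.
apply: pair_extl => w; rewrite pair_act (wh_mul1l whV) (sp_mulr sp) pair_swl.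
by apply: eq_sw2K => a b; rewrite pairZl mulrC.
Qed.

Lemma rarrowE u v : rarrow HU p u v = act u 1v v.
Proof.
apply: pair_extl => w; rewrite pair_act (wh_mul1r whV) (sp_mulr sp) pair_swl.
by apply: eq_sw2K => a b; rewrite pairZl.
Qed.

Lemma inL_act a : inL HU (act 1u a 1v).
Proof. by rewrite -larrowE; apply: inL_leg => //; lin. Qed.

Lemma inR_act b : inR HU (act 1u 1v b).
Proof. by rewrite -rarrowE; apply: inR_leg => //; lin. Qed.

(** The two sums may run over coproducts in different spaces, so that a sum over V can be compared
    with one over U, as in [sw2_1act]. *)
Lemma tensU_ext (W : lmodType K) (F : U -> U -> W) (A B : vectType K)
    (H : hopf_data A) (H' : hopf_data B) x y f g f' g' :
  bil F ->
  (forall v v', sw2 H (W := K^o) x (fun a b => p (f a b) v * p (g a b) v') =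
    sw2 H' (W := K^o) y (fun a b => p (f' a b) v * p (g' a b) v')) ->
  sw2 H x (fun a b => F (f a b) (g a b)) =
  sw2 H' y (fun a b => F (f' a b) (g' a b)).
Proof.
move=> bF E.
suff /(congr1 (tlift F)) : sw2 H x (fun a b => f a b ⊗ g a b) =
    sw2 H' y (fun a b => f' a b ⊗ g' a b).
  rewrite !(sw2_lin (f := fun t => tlift F t)); try exact: islin_tlift.
  under eq_sw2 => a b do rewrite tlift_bil //.
  by under [RHS]eq_sw2 => a b do rewrite tlift_bil //.
apply: (tens_ext (q := fun u v => p u v)) => [v|u0 |v v']; [by lin|exact: nd.1|].
rewrite !(sw2_lin (W' := K^o) (f := fun t => tlift (W := K^o) (fun a b => p a v * p b v') t));
  try exact: islin_tlift.
transitivity (sw2 H (W := K^o) x (fun a b => p (f a b) v * p (g a b) v')).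
  by apply: (eq_sw2 (W := K^o)) => a b; rewrite (tlift_bil (W := K^o)) //; lin.
rewrite E.
by apply: (eq_sw2 (W := K^o)) => a b; rewrite (tlift_bil (W := K^o)) //; lin.
Qed.

Lemma sw2_act (W : lmodType K) (F : U -> U -> W) u a b : bil F ->
  swU (act u a b) F = swU u (fun u1 u2 => F (act u1 a 1v) (act u2 1v b)).
Proof.
move=> bF; rewrite [LHS](eq_sw2 (G := fun x y => F x y)) //.
rewrite (tensU_ext (f := fun x y => x) (g := fun x y => y) (H' := HU) (y := u)
  (f' := fun u1 u2 => act u1 a 1v) (g' := fun u1 u2 => act u2 1v b)) // => v v'.
transitivity (p (act u a b) (v' *v v)).
  by rewrite (sp_mulr sp); apply: (eq_sw2 (W := K^o)) => x y; rewrite mulrC.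
rewrite pair_act (wh_mulA whV) -(wh_mulA whV) (sp_mulr sp); apply: (eq_sw2 (W := K^o)) => x y.
by rewrite !pair_act (wh_mul1l whV) (wh_mul1r whV) mulrC.
Qed.

(** Paired with v and v', both sides give p(u, d v' c b v a): the inner actions meet and only the
    product c b matters. *)
Lemma sw2_act_act (W : lmodType K) (F : U -> U -> W) u a b c d : bil F ->
  swU u (fun u1 u2 => F (act u1 a b) (act u2 c d)) =
  swU u (fun u1 u2 => F (act u1 a 1v) (act u2 (c *v b) d)).
Proof.
move=> bF; apply: (tensU_ext bF (f := fun u1 u2 => act u1 a b) (g := fun u1 u2 => act u2 c d)
  (f' := fun u1 u2 => act u1 a 1v) (g' := fun u1 u2 => act u2 (c *v b) d)) => v v'.
transitivity (p u (d *v v' *v c *v (b *v v *v a))).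
  by rewrite (sp_mulr sp); apply: (eq_sw2 (W := K^o)) => x y; rewrite !pair_act mulrC.
rewrite !(wh_mulA whV) -(wh_mulA whV _ v a) (sp_mulr sp); apply: (eq_sw2 (W := K^o)) => x y.
by rewrite !pair_act (wh_mul1l whV) !(wh_mulA whV) mulrC.
Qed.

(** Both sides pair with v and v' to ε(v' v), on the left through the weak counit axiom of V. *)
Lemma sw2_1act (W : lmodType K) (F : U -> U -> W) : bil F ->
  swV 1v (fun e f => F (act 1u 1v e) (act 1u f 1v)) = swU 1u F.
Proof.
move=> bF; apply: (tensU_ext bF (f := fun e f => act 1u 1v e) (g := fun e f => act 1u f 1v)
  (f' := fun x y => x) (g' := fun x y => y)) => v v'.
rewrite pair_sw1 (counit_mul1' whV); apply: (eq_sw2 (W := K^o)) => e f.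
by rewrite !pair_act1 (wh_mul1l whV) (wh_mul1r whV) mulrC.
Qed.

Lemma antipode_act u a b : Su (act u (Si a) b) = act (Su u) (Sv b) a.
Proof.
apply: pair_extl => v; rewrite (sp_antipode sp) !pair_act (sp_antipode sp).
by rewrite !antipodeVM antipodeKV (wh_mulA whV).
Qed.

(** * The product of the double *)

Local Notation J := (double_span HU HV p).
Local Notation D := (drinfeld_double HU HV p).
Local Notation cl := (dclass HU HV p).

Lemma double_span0 (W : lmodType K) (f : tensor U V -> W) t : islin f ->
  (forall u v x, inL HV x -> f (u ⊗ (x *v v)) = f ((u *u act 1u x 1v) ⊗ v)) ->
  (forall u v y, inR HV y -> f (u ⊗ (y *v v)) = f ((u *u act 1u 1v y) ⊗ v)) ->
  t \in J -> f t = 0.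
Proof.
move=> lf fL fR /lspanP[n [s [c [sJ ->]]]].
rewrite islin_sum // big1 // => i _; rewrite islinZ //.
case: (sJ i) => [[u [v [x [[x0 _ <-] ->]]]]|[u [v [y [[y0 _ <-] ->]]]]].
  by rewrite islinB // fL ?larrowE ?subrr ?scaler0 //; apply: inL_epsL.
by rewrite islinB // fR ?rarrowE ?subrr ?scaler0 //; apply: inR_epsR.
Qed.

(** Evaluation on the chosen representative, defined for every [F]; it agrees with [F] on classes
    once [F] is bilinear and respects the relations, by [dlift_cl]. *)
Definition dlift (W : lmodType K) (F : U -> V -> W) (d : D) : W :=
  tlift F (vsval d).

Lemma islin_dlift (W : lmodType K) (F : U -> V -> W) : islin (dlift F).
Proof.
by apply: (islin_comp (islin_tlift F)); apply: islin_vsval.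
Qed.

Lemma dlift_cl (W : lmodType K) (F : U -> V -> W) u v : bil F ->
  (forall u v x, inL HV x -> F u (x *v v) = F (u *u act 1u x 1v) v) ->
  (forall u v y, inR HV y -> F u (y *v v) = F (u *u act 1u 1v y) v) ->
  dlift F (cl u v) = F u v.
Proof.
move=> bF FL FR; rewrite /dlift /dclass (vsval_quo (f := fun t => tlift F t)).
- by rewrite tlift_bil.
- exact: islin_tlift.
- move=> t; apply: double_span0; first exact: islin_tlift.
    by move=> *; rewrite !tlift_bil // FL.
  by move=> *; rewrite !tlift_bil // FR.
Qed.

Lemma double_ext (W : lmodType K) (f g : D -> W) : islin f -> islin g ->
  (forall u v, f (cl u v) = g (cl u v)) -> forall d, f d = g d.
Proof.
move=> lf lg fg d.
have E h : islin h -> h d = tlift (fun u v => h (cl u v)) (vsval d) :> W.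
  move=> lh; rewrite -{1}(quo_vsval d) -{1}(tensor_span (vsval d)) /tlift.
  rewrite linear_sum islin_sum //; apply: eq_bigr => i _.
  rewrite linear_sum islin_sum //; apply: eq_bigr => j _.
  by rewrite linearZ islinZ.
by rewrite !E //; apply: eq_bigr => i _; apply: eq_bigr => j _; rewrite fg.
Qed.

Lemma cl_rel t t' : double_rel HU HV p (t - t') -> quo J t = quo J t'.
Proof.
move=> tJ; apply/eqP; rewrite -subr_eq0 -linearB -memv_ker lker_quo.
apply/lspanP; exists 1%N, (fun=> t - t'), (fun=> 1); split=> //.
by rewrite big_ord1 scale1r.
Qed.

Lemma cl_inL u v x : inL HV x -> cl (u *u act 1u x 1v) v = cl u (x *v v).
Proof.
move=> Lx; symmetry; apply: cl_rel; left; exists u, v, x; split.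
  by exists x => //; exact: Lx.
by rewrite larrowE.
Qed.

Lemma cl_inR u v y : inR HV y -> cl (u *u act 1u 1v y) v = cl u (y *v v).
Proof.
move=> Ry; symmetry; apply: cl_rel; right; exists u, v, y; split.
  by exists y => //; exact: Ry.
by rewrite rarrowE.
Qed.

(** A relation brings [x] in on the right of [w], whereas [x] itself acts on [w] from the left.
    Since [Si x] lies in V_R and has the same effect on the unit, its action is the required right
    multiplication. *)
Lemma cl_actL u w v x : inL HV x ->
  cl (u *u act w (Si x) 1v) v = cl (u *u w) (x *v v).
Proof.
move=> Lx; rewrite -cl_inL // act_inRl // ?(wh_mulA whU) ?act1_antipodeV_inL //.
exact: inR_antipodeV.
Qed.

Lemma cl_actR u w v y : inR HV y ->
  cl (u *u act w 1v y) v = cl (u *u w) (y *v v).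
Proof. by move=> Ry; rewrite -cl_inR // act_inRr // (wh_mulA whU). Qed.

Definition dprod u v u' v' : D :=
  swV v (fun v1 y => swV y (fun v2 v3 =>
    cl (u *u act u' v1 (Si v3)) (v2 *v v'))).

(** The action on [1u] splits, and its two parts return to V as [epsL v1] and [epsRb v3], which
    recombine with [v2] to [v]. *)
Lemma dprod1r u v v' : dprod u v 1u v' = cl u (v *v v').
Proof.
transitivity (swV v (fun v1 y => swV y (fun v2 v3 =>
    cl u (epsRb HV v3 *v (epsL HV v1 *v v2) *v v')))).
  apply: eq_sw2 => v1 y; apply: eq_sw2 => v2 v3.
  rewrite act1_split -(act1_epsL v1) -(act1_epsR _ (Si v3)).
  rewrite (wh_mulA whU) cl_inR; last exact: inR_epsR.
  rewrite cl_inL; last exact: inL_epsL.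
  rewrite epsR_antipodeV !(wh_mulA whV).
  rewrite (inLR_comm whV (z := epsL HV v1) (y := epsRb HV v3)) //.
    exact: inL_epsL.
  exact: inR_epsRb.
rewrite -sw2_coassoc //; last by lin.
rewrite -[in RHS](epsRb_mul whV v) [RHS](sw2_lin (f := fun t => cl u (t *v v'))); last by lin.
apply: eq_sw2 => y v3; rewrite -[in RHS](epsL_mul whV y).
by rewrite [RHS](sw2_lin (f := fun t => cl u (epsRb HV v3 *v t *v v'))); last by lin.
Qed.

Lemma dprod1l u w v : dprod u 1v w v = cl (u *u w) v.
Proof.
have e1 : epsLb HV 1v = 1v.
  rewrite -[RHS](wh_counitl whV); apply: eq_sw2 => e f.
  by rewrite (wh_mul1l whV).
rewrite /dprod (sw2_sw1r whV (F := fun e b c => cl (u *u act w e (Si c)) (b *v v)));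
  last by lin.
transitivity (swV 1v (fun e e' => cl (u *u act w e 1v) (e' *v v))).
  apply: eq_sw2 => e e'.
  rewrite -(sw2_1R whV (F := fun f f' => cl (u *u act w e (Si f')) (f *v e' *v v)));
    last by lin.
  transitivity (swV 1v (fun f f' => cl (u *u act w e (Si f' *v epsR HV f)) (e' *v v))).
    apply: eq_sw2 => f f'; rewrite -(wh_mulA whV) -cl_actR; last exact: inR_epsR.
    by rewrite act_act (wh_mul1l whV).
  rewrite (sw2_1R whV (F := fun f f' => cl (u *u act w e (Si f' *v f)) (e' *v v)));
    last by lin.
  rewrite -(sw2_lin (f := fun t => cl (u *u act w e t) (e' *v v))); last by lin.
  by rewrite antipodeV_mul e1.
rewrite -(sw2_1L whV (F := fun e e' => cl (u *u act w e 1v) (e' *v v))); last by lin.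
transitivity (swV 1v (fun e e' => cl (u *u act w (Si (epsL HV e') *v e) 1v) v)).
  apply: eq_sw2 => e e'; rewrite -cl_actL; last exact: inL_epsL.
  by rewrite act_act (wh_mul1l whV).
rewrite (sw2_1L whV (F := fun e e' => cl (u *u act w (Si e' *v e) 1v) v)); last by lin.
rewrite -(sw2_lin (f := fun t => cl (u *u act w t 1v) v)); last by lin.
by rewrite antipodeV_mul e1 act11.
Qed.

Lemma dprod_mul u v u' w v' : dprod u v (u' *u w) v' =
  swV v (fun a y => swV y (fun t e =>
    swV t (fun b z => swV z (fun c d =>
      cl (u *u (act u' a (Si e) *u act w b (Si d))) (c *v v'))))).
Proof.
rewrite -(sw2_regroup _ (G := fun a b c d e => cl (u *u (act u' a (Si e) *u act w b (Si d))) (c *v v'))) //;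
  try lin.
apply: eq_sw2 => v1 y; apply: eq_sw2 => v2 v3.
rewrite act_mul (sw2_lin (f := fun t => cl (u *u t) (v2 *v v'))); last by lin.
apply: eq_sw2 => a b; rewrite (sw2_lin (f := fun t => cl (u *u t) (v2 *v v'))); last by lin.
by rewrite sw2_antipodeV //; lin.
Qed.

Lemma dprod_relLl u v x u' v' : inL HV x ->
  dprod u (x *v v) u' v' = dprod (u *u act 1u x 1v) v u' v'.
Proof.
move=> Lx; rewrite /dprod sw2_Lmul //; last by lin.
apply: eq_sw2 => v1 y; apply: eq_sw2 => v2 v3.
rewrite -(wh_mulA whU) -act_inLl //.
by rewrite act_act (wh_mul1r whV).
Qed.

Lemma dprod_relLr u v y u' v' : inR HV y ->
  dprod u (y *v v) u' v' = dprod (u *u act 1u 1v y) v u' v'.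
Proof.
move=> Ry; rewrite /dprod sw2_Rmul //; last by lin.
apply: eq_sw2 => v1 t; rewrite sw2_Rmul //; last by lin.
apply: eq_sw2 => v2 v3.
rewrite -(wh_mulA whU) -act1_antipodeV_inR //.
rewrite -act_inLr; last exact: inL_antipodeV.
by rewrite act_act (wh_mul1l whV) antipodeVM.
Qed.

Lemma dprod_relRl u v x u' v' : inL HV x ->
  dprod u v u' (x *v v') = dprod u v (u' *u act 1u x 1v) v'.
Proof.
move=> Lx; rewrite dprod_mul; apply: eq_sw2 => a y; apply: eq_sw2 => t e.
(* Read backwards, [dprod1r] creates an action of the legs of t x on [1u]; [x] stays with the first
   leg and so becomes an action on the unit. *)
rewrite (wh_mulA whV) -dprod1r /dprod sw2_mulL //; last by lin.
apply: eq_sw2 => b z; apply: eq_sw2 => c d.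
by rewrite (wh_mulA whU) act_act (wh_mul1l whV).
Qed.

Lemma dprod_relRr u v y u' v' : inR HV y ->
  dprod u v u' (y *v v') = dprod u v (u' *u act 1u 1v y) v'.
Proof.
move=> Ry; rewrite dprod_mul; apply: eq_sw2 => a s; apply: eq_sw2 => t e.
rewrite (wh_mulA whV) -dprod1r /dprod sw2_mulR //; last by lin.
apply: eq_sw2 => b z; rewrite sw2_mulR //; last by lin.
apply: eq_sw2 => c d.
rewrite (wh_mulA whU) act_act (wh_mul1r whV) antipodeVM.
(* It remains to replace [Si y] by [y] as the leftmost factor under the counit, where
   [Si y = epsLb y] has the same effect. *)
congr (cl (_ *u _) _); apply: pair_extl => w; rewrite !pair_act1.
by rewrite antipodeV_inR // -!(wh_mulA whV) counit_epsLb_mul.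
Qed.

Definition dmul (d d' : D) : D := dlift (fun u v => dlift (dprod u v) d') d.

Lemma bil_dprod u v : bil (dprod u v).
Proof. by rewrite /dprod; lin. Qed.

Lemma dmul_cl u v u' v' : dmul (cl u v) (cl u' v') = dprod u v u' v'.
Proof.
have E u0 v0 : dlift (dprod u0 v0) (cl u' v') = dprod u0 v0 u' v'.
  apply: dlift_cl; first exact: bil_dprod.
    by move=> *; apply: dprod_relRl.
  by move=> *; apply: dprod_relRr.
rewrite /dmul (_ : (fun u v => _) = (fun u v => dprod u v u' v')).
  apply: (dlift_cl (F := fun u v => dprod u v u' v')); first by rewrite /dprod; lin.
    by move=> *; apply: dprod_relLl.
  by move=> *; apply: dprod_relLr.
by apply/funext => u0; apply/funext => v0.
Qed.

Lemma dmul_bilinear : bilinear_for *:%R *:%R dmul.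
Proof.
split=> [d'|d] a x y; first exact: islin_dlift.
apply: (islin_tliftF (vsval d) (F := fun x u v => dlift (dprod u v) x)).
by move=> u v; apply: islin_dlift.
Qed.

HB.instance Definition _ :=
  bilinear_isBilinear.Build K D D D _ _ dmul dmul_bilinear.

Lemma islin_dmul_l d : islin (fun x => dmul x d).
Proof. by move=> a x y; apply: dmul_bilinear.1. Qed.

Lemma islin_dmul_r d : islin (fun x => dmul d x).
Proof. by move=> a x y; apply: dmul_bilinear.2. Qed.

Lemma dmulA : associative dmul.
Proof.
move=> d d' d''.
apply: (double_ext (f := fun d => dmul d (dmul d' d''))
  (g := fun d => dmul (dmul d d') d'')) => [||u v].
- exact: islin_dmul_l.
- apply: (islin_comp (islin_dmul_l d'')); exact: islin_dmul_l.
apply: (double_ext (f := fun d' => dmul (cl u v) (dmul d' d''))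
  (g := fun d' => dmul (dmul (cl u v) d') d'')) => [||u' v'].
- apply: (islin_comp (islin_dmul_r _)); exact: islin_dmul_l.
- apply: (islin_comp (islin_dmul_l d'')); exact: islin_dmul_r.
apply: (double_ext (f := fun d'' => dmul (cl u v) (dmul (cl u' v') d''))
  (g := fun d'' => dmul (dmul (cl u v) (cl u' v')) d'')) => [||u'' v''].
- apply: (islin_comp (islin_dmul_r _)); exact: islin_dmul_r.
- exact: islin_dmul_r.
rewrite !dmul_cl.
(* Common normal form: one bracketing reaches it by distributing the action over a product in U, the
   other by multiplicativity of the coproduct of V. *)
transitivity (swV v (fun a y => swV y (fun t e =>
    swV t (fun b z => swV z (fun c d => swV v' (fun q1 z' => swV z' (fun q2 q3 =>
      cl (u *u (act u' a (Si e) *u act u'' (b *v q1) (Si (d *v q3))))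
         (c *v q2 *v v'')))))))).
  rewrite /dprod (sw2_lin (f := fun t => dmul (cl u v) t)); last exact: islin_dmul_r.
  transitivity (swV v' (fun q1 z' => swV z' (fun q2 q3 =>
      dprod u v (u' *u act u'' q1 (Si q3)) (q2 *v v'')))).
    apply: eq_sw2 => q1 z'; rewrite (sw2_lin (f := fun t => dmul (cl u v) t));
      last exact: islin_dmul_r.
    by apply: eq_sw2 => q2 q3; rewrite dmul_cl.
  transitivity (swV v' (fun q1 z' => swV v (fun a y => swV y (fun t e =>
    swV t (fun b z => swV z (fun c d => swV z' (fun q2 q3 =>
      cl (u *u (act u' a (Si e) *u act u'' (b *v q1) (Si (d *v q3))))
         (c *v q2 *v v'')))))))).
    apply: eq_sw2 => q1 z'.
    transitivity (swV v (fun a y => swV z' (fun q2 q3 => swV y (fun t e =>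
    swV t (fun b z => swV z (fun c d =>
      cl (u *u (act u' a (Si e) *u act u'' (b *v q1) (Si (d *v q3))))
         (c *v q2 *v v''))))))).
      rewrite [RHS]sw2_exch; apply: eq_sw2 => q2 q3; rewrite dprod_mul.
      do 4!(apply: eq_sw2 => ? ?).
      by rewrite act_act antipodeVM !(wh_mulA whV).
    apply: eq_sw2 => a y; rewrite sw2_exch; apply: eq_sw2 => t e.
    by rewrite sw2_exch; apply: eq_sw2 => b z; rewrite sw2_exch.
  rewrite sw2_exch; apply: eq_sw2 => a y; rewrite sw2_exch; apply: eq_sw2 => t e.
  by rewrite sw2_exch; apply: eq_sw2 => b z; rewrite sw2_exch.
rewrite [in RHS]/dprod [RHS](sw2_lin (f := fun t => dmul t (cl u'' v'')));
  last exact: islin_dmul_l.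
apply: eq_sw2 => a y; rewrite [RHS](sw2_lin (f := fun t => dmul t (cl u'' v'')));
  last exact: islin_dmul_l.
apply: eq_sw2 => t e; rewrite dmul_cl /dprod sw2_mul //; last by lin.
apply: eq_sw2 => b z; rewrite sw2_exch; apply: eq_sw2 => q1 z'.
rewrite sw2_mul //; last by lin.
by apply: eq_sw2 => c f; apply: eq_sw2 => q2 q3; rewrite (wh_mulA whU).
Qed.

Definition dunit := cl 1u 1v.

Lemma dmul1d : left_id dunit dmul.
Proof.
apply: double_ext => [|//|u v]; first exact: islin_dmul_r.
by rewrite dmul_cl dprod1l (wh_mul1l whU).
Qed.

Lemma dmuld1 : right_id dunit dmul.
Proof.
apply: double_ext => [|//|u v]; first exact: islin_dmul_l.
by rewrite dmul_cl dprod1r (wh_mul1r whV).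
Qed.

Lemma dprodE u v u' v' : dprod u v u' v' =
  sw3 HU u' (fun u1 u2 u3 => sw3 HV v (fun v1 v2 v3 =>
    (p u1 v1 * p u3 (Si v3)) *: cl (u *u u2) (v2 *v v'))).
Proof.
rewrite /dprod -sw2_coassoc //; last by lin.
rewrite /act /sw3.
transitivity (swV v (fun y v3 => swV y (fun v1 v2 => swU u' (fun z u3 => swU z (fun u1 u2 =>
    (p u1 v1 * p u3 (Si v3)) *: cl (u *u u2) (v2 *v v')))))).
  apply: eq_sw2 => y v3; apply: eq_sw2 => v1 v2.
  rewrite (sw2_lin (f := fun t => cl (u *u t) (v2 *v v'))); last by lin.
  apply: eq_sw2 => z u3.
  rewrite (sw2_lin (f := fun t => cl (u *u t) (v2 *v v'))); last by lin.
  by apply: eq_sw2 => u1 u2; rewrite (islinZ (f := fun t => cl (u *u t) (v2 *v v'))) //; lin.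
under eq_sw2 => y v3 do rewrite sw2_exch.
rewrite sw2_exch; apply: eq_sw2 => z u3.
under eq_sw2 => y v3 do rewrite sw2_exch.
by rewrite sw2_exch.
Qed.

(** * The weak Hopf algebra axioms for the double *)

Definition dcomul_fun : D -> tensor D D :=
  dlift (fun u v => swU u (fun u1 u2 => swV v (fun v1 v2 => cl u1 v1 ⊗ cl u2 v2))).

(** By [epsR_antipodeV], [epsRb] is the map [epsR] after [Si] of the stated formula. *)
Definition dcounit_fun : D -> K :=
  dlift (W := K^o) (fun u v => p u (epsRb HV v)).

(** The antipode as S(v) S(u), a form in which antimultiplicativity does the work; [dantipode_clE]
    recovers the explicit formula. *)
Definition dantipode_fun : D -> D :=
  dlift (fun u v => dmul (cl 1u (Sv v)) (cl (Su u) 1v)).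

HB.instance Definition _ :=
  GRing.isLinear.Build K D (tensor D D) *:%R dcomul_fun (islin_dlift _).

HB.instance Definition _ :=
  GRing.isLinear.Build K D K *%R dcounit_fun (@islin_dlift K^o _).

HB.instance Definition _ :=
  GRing.isLinear.Build K D D *:%R dantipode_fun (islin_dlift _).

Definition double_data : hopf_data D :=
  HopfData dmul dunit dcomul_fun dcounit_fun (linfun dantipode_fun).

Local Notation DD := double_data.
Local Notation "x *d y" := (hmul DD x y) (at level 40, left associativity).
Local Notation swD := (sw2 DD).
Local Notation ε := (hcounit DD).
Local Notation iU u := (cl u 1v).
Local Notation iV v := (cl 1u v).

Lemma double_mulA : associative (hmul DD).
Proof. exact: dmulA. Qed.

Lemma double_mul_cl u v u' v' : cl u v *d cl u' v' = dprod u v u' v'.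
Proof. exact: dmul_cl. Qed.

Lemma iU_mul_cl u u' v : iU u *d cl u' v = cl (u *u u') v.
Proof. by rewrite double_mul_cl dprod1l. Qed.

Lemma cl_mul_iV u v v' : cl u v *d iV v' = cl u (v *v v').
Proof. by rewrite double_mul_cl dprod1r. Qed.

Lemma clE u v : cl u v = iU u *d iV v.
Proof. by rewrite cl_mul_iV (wh_mul1l whV). Qed.

Lemma iV_inL x : inL HV x -> iV x = iU (act 1u x 1v).
Proof.
by move=> Lx; have := cl_inL 1u 1v Lx; rewrite (wh_mul1l whU) (wh_mul1r whV).
Qed.

Lemma iV_inR y : inR HV y -> iV y = iU (act 1u 1v y).
Proof.
by move=> Ry; have := cl_inR 1u 1v Ry; rewrite (wh_mul1l whU) (wh_mul1r whV).
Qed.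

Lemma dcomul_cl u v : hcomul DD (cl u v) =
  swU u (fun u1 u2 => swV v (fun v1 v2 => cl u1 v1 ⊗ cl u2 v2)).
Proof.
apply: dlift_cl => [|u0 v0 x Lx|u0 v0 y Ry]; first by lin.
  rewrite sw2_mulL //; [|by lin|exact: inL_act].
  apply: eq_sw2 => u1 u2; rewrite sw2_Lmul //; last by lin.
  by apply: eq_sw2 => v1 v2; rewrite cl_inL.
rewrite sw2_mulR //; [|by lin|exact: inR_act].
apply: eq_sw2 => u1 u2; rewrite sw2_Rmul //; last by lin.
by apply: eq_sw2 => v1 v2; rewrite cl_inR.
Qed.

Lemma sw2_cl (W : lmodType K) (F : D -> D -> W) u v : bil F ->
  swD (cl u v) F =
  swU u (fun u1 u2 => swV v (fun v1 v2 => F (cl u1 v1) (cl u2 v2))).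
Proof.
move=> bF; rewrite (sw2_def F (dcomul_cl u v)).
rewrite (sw2_lin (f := fun t => tlift F t)); last exact: islin_tlift.
apply: eq_sw2 => u1 u2; rewrite (sw2_lin (f := fun t => tlift F t)); last exact: islin_tlift.
by apply: eq_sw2 => v1 v2; rewrite tlift_bil.
Qed.

(** Compatibility with the relations comes from writing [epsRb v] as the sum of v2 Si(v1): an
    element of V_L arrives on the right as [Si x], one of V_R on the left. *)
Lemma dcounit_cl u v : ε (cl u v) = p u (epsRb HV v).
Proof.
apply: (dlift_cl (W := K^o)) => [|u0 v0 x Lx|u0 v0 y Ry]; first by lin.
  rewrite -act1_antipodeV_inL // -act_inRl; last exact: inR_antipodeV.
  rewrite pair_act (wh_mul1l whV) -!mul_antipodeV sw2_Lmul //; last by lin.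
  rewrite (sw2_lin (f := fun t => t *v Si x)); last by lin.
  by congr (p _ _); apply: eq_sw2 => a b; rewrite antipodeVM (wh_mulA whV).
rewrite -act_inRr // pair_act (wh_mul1r whV) -!mul_antipodeV sw2_Rmul //; last by lin.
rewrite (sw2_lin (f := fun t => y *v t)); last by lin.
by congr (p _ _); apply: eq_sw2 => a b; rewrite (wh_mulA whV).
Qed.

Lemma antipode_act1l x : Su (act 1u x 1v) = act 1u 1v (Sv x).
Proof.
by rewrite -[x in LHS]antipodeKV antipode_act (antipode1 whU) (antipode1 whV).
Qed.

Lemma antipode_act1r y : Su (act 1u 1v y) = act 1u (Sv y) 1v.
Proof.
by rewrite -[1v in LHS]antipodeKV antipode_act (antipode1 whU) (antipode1 whV).
Qed.

(** The antipodes of U and V respect the identification of the counital subalgebras, so the image of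
    a relation reads (S(v) S(x)) S(u) = S(v) (S(x) S(u)). *)
Lemma dantipode_cl u v : hantipode DD (cl u v) = iV (Sv v) *d iU (Su u).
Proof.
rewrite lfunE /=; apply: (dlift_cl (F := fun u v => iV (Sv v) *d iU (Su u)))
    => [|u0 v0 x Lx|u0 v0 y Ry]; first by lin.
  rewrite (antipodeM whV) (antipodeM whU) -cl_mul_iV -iU_mul_cl antipode_act1l.
  by rewrite -iV_inR ?double_mulA //; apply: inR_antipode.
rewrite (antipodeM whV) (antipodeM whU) -cl_mul_iV -iU_mul_cl antipode_act1r.
by rewrite -iV_inL ?double_mulA //; apply: inL_antipode.
Qed.

Lemma dantipode_clE u v : hantipode DD (cl u v) =
  sw3 HU u (fun u1 u2 u3 => sw3 HV v (fun v1 v2 v3 =>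
    (p u3 v3 * p u1 (Si v1)) *: cl (Su u2) (Sv v2))).
Proof.
rewrite dantipode_cl double_mul_cl /dprod sw2_antipode; last by lin.
transitivity (swV v (fun y v3 => swV y (fun v1 v2 => cl (Su (act u (Si v1) v3)) (Sv v2)))).
  apply: eq_sw2 => y v3; rewrite sw2_antipode; last by lin.
  apply: eq_sw2 => v1 v2.
  by rewrite antipodeKV antipode_act (wh_mul1l whU) (wh_mul1r whV).
rewrite /act /sw3.
transitivity (swV v (fun y v3 => swV y (fun v1 v2 => swU u (fun z u3 => swU z (fun u1 u2 =>
    (p u3 v3 * p u1 (Si v1)) *: cl (Su u2) (Sv v2)))))).
  apply: eq_sw2 => y v3; apply: eq_sw2 => v1 v2.
  rewrite (sw2_lin (f := fun t => cl (Su t) (Sv v2))); last by lin.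
  apply: eq_sw2 => z u3.
  rewrite (sw2_lin (f := fun t => cl (Su t) (Sv v2))); last by lin.
  apply: eq_sw2 => u1 u2; rewrite (islinZ (f := fun t => cl (Su t) (Sv v2))); last by lin.
  by rewrite mulrC.
under eq_sw2 => y v3 do rewrite sw2_exch.
rewrite sw2_exch; apply: eq_sw2 => z u3.
under eq_sw2 => y v3 do rewrite sw2_exch.
by rewrite sw2_exch.
Qed.

(** The legs of Δ(1_V) lie in V_R and V_L; the relations carry them to U, where by [sw2_1act] they
    form Δ(1_U), which Δ(u) absorbs. *)
Lemma sw2_iU (W : lmodType K) (F : D -> D -> W) u : bil F ->
  swD (iU u) F = swU u (fun a b => F (iU a) (iU b)).
Proof.
move=> bF; rewrite sw2_cl //.
rewrite -[RHS](sw2_mul1 whU); last by lin.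
apply: eq_sw2 => u1 u2.
rewrite -(sw2_1act (F := fun a b => F (iU (u1 *u a)) (iU (u2 *u b)))); last by lin.
rewrite -(sw2_1L whV) -?(sw2_1R whV (F := fun e f => F (cl u1 e) (cl u2 (epsL HV f))));
  try by lin.
rewrite -[RHS](sw2_1L whV) -?(sw2_1R whV (F := fun e f => F (iU (u1 *u act 1u 1v e)) (iU (u2 *u act 1u (epsL HV f) 1v))));
  try by lin.
apply: eq_sw2 => e f; rewrite cl_inR ?cl_inL ?(wh_mul1r whV) //.
  exact: inL_epsL.
exact: inR_epsR.
Qed.

Lemma sw2_iV (W : lmodType K) (F : D -> D -> W) v : bil F ->
  swD (iV v) F = swV v (fun a b => F (iV a) (iV b)).
Proof.
move=> bF; rewrite sw2_cl // sw2_exch -[RHS](sw2_1mul whV); last by lin.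
rewrite [RHS]sw2_exch; apply: eq_sw2 => v1 v2.
rewrite -(sw2_1act (F := fun a b => F (cl a v1) (cl b v2))); last by lin.
rewrite -(sw2_1L whV) -?(sw2_1R whV (F := fun e f => F (cl (act 1u 1v e) v1) (cl (act 1u (epsL HV f) 1v) v2)));
  try by lin.
rewrite -[RHS](sw2_1L whV) -?(sw2_1R whV (F := fun e f => F (iV (e *v v1)) (iV (epsL HV f *v v2))));
  try by lin.
apply: eq_sw2 => e f; rewrite -cl_inR -?cl_inL ?(wh_mul1l whU) //.
  exact: inL_epsL.
exact: inR_epsR.
Qed.

Lemma double_coassoc (W : lmodType K) (F : D -> D -> D -> W) d : tri F ->
  swD d (fun y c => swD y (fun a b => F a b c)) =
  swD d (fun a y => swD y (fun b c => F a b c)).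
Proof.
move=> tF; apply: (double_ext (f := fun d => swD d (fun y c => swD y (fun a b => F a b c)))
  (g := fun d => swD d (fun a y => swD y (fun b c => F a b c)))) => [||u v]; try by lin.
rewrite !sw2_cl; try by lin.
transitivity (swU u (fun y u3 => swU y (fun u1 u2 =>
    swV v (fun z v3 => swV z (fun v1 v2 => F (cl u1 v1) (cl u2 v2) (cl u3 v3)))))).
  apply: eq_sw2 => y u3; rewrite -[RHS]sw2_exch; apply: eq_sw2 => z v3.
  by rewrite sw2_cl //; lin.
rewrite sw2_coassoc //; last by lin.
apply: eq_sw2 => u1 y.
transitivity (swU y (fun u2 u3 => swV v (fun v1 z => swV z (fun v2 v3 =>
    F (cl u1 v1) (cl u2 v2) (cl u3 v3))))).
  by apply: eq_sw2 => u2 u3; rewrite sw2_coassoc //; lin.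
rewrite sw2_exch; apply: eq_sw2 => v1 z.
by rewrite sw2_cl //; lin.
Qed.

Lemma antipodeV_epsL v : Si (epsL HV v) = epsRb HV v.
Proof. by rewrite -(antipode_epsRb whV) antipodeKV. Qed.

(** The counit turns the sum over [u] into an arrow by [epsRb v1], which is [Si (epsL v1)]; hence
    [cl_actL] returns [epsL v1] to V. *)
Lemma double_counitl d : swD d (fun a b => ε a *: b) = d.
Proof.
apply: (double_ext (f := fun d => swD d (fun a b => ε a *: b)) (g := fun d => d)) => [||u v];
  try by lin.
rewrite sw2_cl; last by lin.
transitivity (swV v (fun v1 v2 => cl u (epsL HV v1 *v v2))).
  rewrite sw2_exch; apply: eq_sw2 => v1 v2.
  transitivity (cl (1u *u act u (Si (epsL HV v1)) 1v) v2).
    rewrite (wh_mul1l whU) antipodeV_epsL -larrowE.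
    rewrite [RHS](sw2_lin (f := fun t => cl t v2)); last by lin.
    apply: eq_sw2 => a b; rewrite dcounit_cl.
    by rewrite [RHS](islinZ (f := fun t => cl t v2)) //; lin.
  by rewrite cl_actL ?(wh_mul1l whU) //; apply: inL_epsL.
by rewrite -(sw2_lin (f := fun t => cl u t)) ?(epsL_mul whV) //; lin.
Qed.

Lemma double_counitr d : swD d (fun a b => ε b *: a) = d.
Proof.
apply: (double_ext (f := fun d => swD d (fun a b => ε b *: a)) (g := fun d => d)) => [||u v];
  try by lin.
rewrite sw2_cl; last by lin.
transitivity (swV v (fun v1 v2 => cl u (epsRb HV v2 *v v1))).
  rewrite sw2_exch; apply: eq_sw2 => v1 v2.
  transitivity (cl (1u *u act u 1v (epsRb HV v2)) v1).
    rewrite (wh_mul1l whU) -rarrowE.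
    rewrite [RHS](sw2_lin (f := fun t => cl t v1)); last by lin.
    apply: eq_sw2 => a b; rewrite dcounit_cl.
    by rewrite [RHS](islinZ (f := fun t => cl t v1)) //; lin.
  by rewrite cl_actR ?(wh_mul1l whU) //; apply: inR_epsRb.
by rewrite -(sw2_lin (f := fun t => cl u t)) ?(epsRb_mul whV) //; lin.
Qed.

(* Expanding both factors, the legs [v3] and [v4] of [v] that meet in the middle
   combine to [v4 Si v3 = epsRb v3], which the relations of the quotient move
   back to [V], where it is absorbed. *)
Lemma sw2_dprod (W : lmodType K) (F : D -> D -> W) a b v u' m n : bil F ->
  swV v (fun s t => swU u' (fun c d => F (dprod a s c m) (dprod b t d n))) =
  swV v (fun v1 y => swV y (fun v2 v3 => swV v2 (fun k l =>
    swU u' (fun c d => F (cl (a *u act c v1 1v) (k *v m))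
                         (cl (b *u act d 1v (Si v3)) (l *v n)))))).
Proof.
move=> bF.
(* The summand after [sw2_act_act] has moved [Si s3] from [c] to [d], next to [t1]. *)
pose G s1 s2 s3 t1 t2 t3 := swU u' (fun c d =>
  F (cl (a *u act c s1 1v) (s2 *v m))
    (cl (b *u act d (t1 *v Si s3) (Si t3)) (t2 *v n))).
transitivity (swV v (fun s t => swV s (fun s1 s' => swV s' (fun s2 s3 =>
    swV t (fun t1 t' => swV t' (fun t2 t3 => G s1 s2 s3 t1 t2 t3)))))).
  apply: eq_sw2 => s t.
  transitivity (swU u' (fun c d => swV s (fun s1 s' => swV s' (fun s2 s3 =>
    swV t (fun t1 t' => swV t' (fun t2 t3 =>
      F (cl (a *u act c s1 (Si s3)) (s2 *v m))
        (cl (b *u act d t1 (Si t3)) (t2 *v n)))))))).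
    apply: eq_sw2 => c d.
    rewrite {1}/dprod (sw2_lin (f := fun z => F z (dprod b t d n))); last by lin.
    apply: eq_sw2 => s1 s'; rewrite (sw2_lin (f := fun z => F z (dprod b t d n))); last by lin.
    apply: eq_sw2 => s2 s3; rewrite /dprod (sw2_lin (f := fun z => F (cl (a *u act c s1 (Si s3)) (s2 *v m)) z));
      last by lin.
    apply: eq_sw2 => t1 t'; rewrite (sw2_lin (f := fun z => F (cl (a *u act c s1 (Si s3)) (s2 *v m)) z));
      last by lin.
    by [].
  rewrite sw2_exch; apply: eq_sw2 => s1 s'; rewrite sw2_exch; apply: eq_sw2 => s2 s3.
  rewrite sw2_exch; apply: eq_sw2 => t1 t'; rewrite sw2_exch; apply: eq_sw2 => t2 t3.
  rewrite /G (sw2_act_act (F := fun x y => F (cl (a *u x) (s2 *v m)) (cl (b *u y) (t2 *v n)))) //.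
  by lin.
rewrite (sw2_coassoc whV (F := fun s1 s' t => swV s' (fun s2 s3 => swV t (fun t1 t' => swV t' (fun t2 t3 =>
  G s1 s2 s3 t1 t2 t3))))); last by rewrite /G; lin.
apply: eq_sw2 => s1 q.
rewrite (sw2_coassoc whV (F := fun s2 s3 t => swV t (fun t1 t' => swV t' (fun t2 t3 =>
  G s1 s2 s3 t1 t2 t3)))); last by rewrite /G; lin.
transitivity (swV q (fun s2 q' => swV q' (fun r t' => swV t' (fun t2 t3 =>
    swU u' (fun c d => F (cl (a *u act c s1 1v) (s2 *v m))
      (cl (b *u act d 1v (Si t3)) (epsL HV r *v t2 *v n))))))).
  apply: eq_sw2 => s2 q'.
  rewrite -(sw2_coassoc whV (F := fun s3 t1 t' => swV t' (fun t2 t3 =>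
    G s1 s2 s3 t1 t2 t3))); last by rewrite /G; lin.
  apply: eq_sw2 => r t'; rewrite sw2_exch; apply: eq_sw2 => t2 t3.
  rewrite /G sw2_exch; apply: eq_sw2 => c d.
  rewrite -(wh_mulA whV) -(cl_actL b _ _ (inL_epsL whV r)).
  rewrite antipodeV_epsL act_act -mul_antipodeV !(wh_mul1r whV).
  by rewrite [RHS](sw2_lin (f := fun z => F (cl (a *u act c s1 1v) (s2 *v m))
      (cl (b *u act d z (Si t3)) (t2 *v n)))) //; lin.
rewrite [RHS]sw2_coassoc //; last by lin.
apply: eq_sw2 => s2 q'.
rewrite -(sw2_coassoc whV (F := fun r t2 t3 => swU u' (fun c d => F (cl (a *u act c s1 1v) (s2 *v m))
      (cl (b *u act d 1v (Si t3)) (epsL HV r *v t2 *v n))))); last by lin.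
apply: eq_sw2 => l t3; rewrite -[in RHS](epsL_mul whV l).
by rewrite [RHS](sw2_lin (f := fun z => swU u' (fun c d => F (cl (a *u act c s1 1v) (s2 *v m))
      (cl (b *u act d 1v (Si t3)) (z *v n))))) //; lin.
Qed.

Lemma double_comulM x y : hcomul DD (x *d y) =
  swD x (fun x1 x2 => swD y (fun y1 y2 => (x1 *d y1) ⊗ (x2 *d y2))).
Proof.
apply: (double_ext (f := fun x => hcomul DD (x *d y)) (g := fun x =>
  swD x (fun x1 x2 => swD y (fun y1 y2 => (x1 *d y1) ⊗ (x2 *d y2))))) => [||u v]; try by lin.
apply: (double_ext (f := fun y => hcomul DD (cl u v *d y)) (g := fun y =>
  swD (cl u v) (fun x1 x2 => swD y (fun y1 y2 => (x1 *d y1) ⊗ (x2 *d y2))))) => [||u' v'];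
    try by lin.
rewrite double_mul_cl -sw2_tens sw2_cl; last by lin.
pose F x y : tensor D D := x ⊗ y.
have bF : bil F by exact: bil_tens.
transitivity (swU u (fun a b => swV v' (fun m n => swV v (fun s t => swU u' (fun c d =>
    F (dprod a s c m) (dprod b t d n)))))).
  rewrite {1}/dprod.
  transitivity (swU u (fun a b => swV v' (fun m n => swV v (fun v1 y => swV y (fun v2 v3 =>
      swV v2 (fun k l => swU u' (fun c d => F (cl (a *u act c v1 1v) (k *v m))
                         (cl (b *u act d 1v (Si v3)) (l *v n))))))))); last first.
    by apply: eq_sw2 => a b; apply: eq_sw2 => m n; rewrite sw2_dprod.
  transitivity (swV v (fun v1 y => swV y (fun v2 v3 => swU u (fun a b => swV v' (fun m n =>
      swV v2 (fun k l => swU u' (fun c d => F (cl (a *u act c v1 1v) (k *v m))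
                         (cl (b *u act d 1v (Si v3)) (l *v n))))))))); last first.
    rewrite [RHS](eq_sw2 (G := fun a b => swV v (fun v1 y => swV v' (fun m n => swV y (fun v2 v3 =>
      swV v2 (fun k l => swU u' (fun c d => F (cl (a *u act c v1 1v) (k *v m))
                         (cl (b *u act d 1v (Si v3)) (l *v n))))))))); last first.
      by move=> a b; rewrite sw2_exch.
    rewrite [RHS]sw2_exch; apply: eq_sw2 => v1 y0.
    rewrite [RHS](eq_sw2 (G := fun a b => swV y0 (fun v2 v3 => swV v' (fun m n =>
      swV v2 (fun k l => swU u' (fun c d => F (cl (a *u act c v1 1v) (k *v m))
                         (cl (b *u act d 1v (Si v3)) (l *v n)))))))); last first.
      by move=> a b; rewrite sw2_exch.
    by rewrite [RHS]sw2_exch.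
  rewrite (sw2_lin (f := fun z => swD z F)); last by lin.
  apply: eq_sw2 => v1 y0; rewrite (sw2_lin (f := fun z => swD z F)); last by lin.
  apply: eq_sw2 => v2 v3; rewrite sw2_cl // sw2_mul //; last by lin.
  apply: eq_sw2 => a b; rewrite sw2_act; last by lin.
  rewrite [RHS](eq_sw2 (G := fun m n => swU u' (fun c d => swV v2 (fun k l =>
       F (cl (a *u act c v1 1v) (k *v m))
                         (cl (b *u act d 1v (Si v3)) (l *v n)))))); last first.
    by move=> m n; rewrite sw2_exch.
  rewrite [RHS]sw2_exch; apply: eq_sw2 => c d; rewrite sw2_mul //; last by lin.
  by rewrite sw2_exch.
apply: eq_sw2 => a b.
rewrite sw2_exch; apply: eq_sw2 => s t.
rewrite sw2_cl; last by lin.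
rewrite sw2_exch; apply: eq_sw2 => c d; apply: eq_sw2 => m n.
by rewrite !double_mul_cl.
Qed.

Lemma iUM u u' : iU (u *u u') = iU u *d iU u'.
Proof. by rewrite iU_mul_cl. Qed.

Lemma iVM v v' : iV (v *v v') = iV v *d iV v'.
Proof. by rewrite cl_mul_iV. Qed.

Lemma double_comul1l : sw3 DD dunit (fun e1 e2 e3 => e1 ⊗ (e2 ⊗ e3)) =
  swD dunit (fun e1 e2 => swD dunit (fun f1 f2 => e1 ⊗ ((e2 *d f1) ⊗ f2))).
Proof.
rewrite /sw3 double_coassoc; last by lin.
rewrite sw2_iU; last by lin.
transitivity (swU 1u (fun a y => swU y (fun b c => iU a ⊗ (iU b ⊗ iU c)))).
  by apply: eq_sw2 => a y; rewrite sw2_iU //; lin.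
rewrite sw2_sw1l //; last by lin.
rewrite [RHS]sw2_iU; last by lin.
by apply: eq_sw2 => e e'; rewrite sw2_iU; [under eq_sw2 => f f' do rewrite iUM|by lin].
Qed.

Lemma double_comul1r : sw3 DD dunit (fun e1 e2 e3 => e1 ⊗ (e2 ⊗ e3)) =
  swD dunit (fun e1 e2 => swD dunit (fun f1 f2 => e1 ⊗ ((f1 *d e2) ⊗ f2))).
Proof.
rewrite /sw3 double_coassoc; last by lin.
rewrite sw2_iU; last by lin.
transitivity (swU 1u (fun a y => swU y (fun b c => iU a ⊗ (iU b ⊗ iU c)))).
  by apply: eq_sw2 => a y; rewrite sw2_iU //; lin.
rewrite sw2_sw1r //; last by lin.
rewrite [RHS]sw2_iU; last by lin.
by apply: eq_sw2 => e e'; rewrite sw2_iU; [under eq_sw2 => f f' do rewrite iUM|by lin].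
Qed.

(** * The weak counit axioms *)

Lemma epsRb_mul_epsL w v : epsRb HV (w *v epsL HV v) = epsRb HV (w *v v).
Proof.
apply: eq_sw2 => e f; rewrite !(wh_mulA whV).
by rewrite (counit_mul_epsL whV).
Qed.

Lemma epsRb_mul_epsRb w v : epsRb HV (w *v epsRb HV v) = epsRb HV (w *v v).
Proof.
apply: eq_sw2 => e f; rewrite !(wh_mulA whV).
by rewrite (counit_mul_epsRb whV).
Qed.

Lemma epsRb1 : epsRb HV 1v = 1v.
Proof.
rewrite -[RHS](wh_counitr whV); apply: eq_sw2 => e f.
by rewrite (wh_mul1r whV).
Qed.

Lemma dcounit_iU u : ε (iU u) = hcounit HU u.
Proof. by rewrite dcounit_cl epsRb1 (sp_oner sp). Qed.

Lemma dcounit_iV v : ε (iV v) = hcounit HV v.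
Proof.
by rewrite dcounit_cl (sp_onel sp) -[epsRb HV v](wh_mul1l whV) counit_mul_epsRb //
  (wh_mul1l whV).
Qed.

Lemma dcounit_mul_epsL q v : ε (q *d iV (epsL HV v)) = ε (q *d iV v).
Proof.
apply: (double_ext (W := K^o) (f := fun q => ε (q *d iV (epsL HV v)))
  (g := fun q => ε (q *d iV v))) => [||u0 v0]; try by lin.
by rewrite !cl_mul_iV !dcounit_cl epsRb_mul_epsL.
Qed.

Lemma dcounit_mul_epsRb q v : ε (q *d iV (epsRb HV v)) = ε (q *d iV v).
Proof.
apply: (double_ext (W := K^o) (f := fun q => ε (q *d iV (epsRb HV v)))
  (g := fun q => ε (q *d iV v))) => [||u0 v0]; try by lin.
by rewrite !cl_mul_iV !dcounit_cl epsRb_mul_epsRb.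
Qed.

Lemma dcounit_epsR_mul q u : ε (iU (epsR HU u) *d q) = ε (iU u *d q).
Proof.
apply: (double_ext (W := K^o) (f := fun q => ε (iU (epsR HU u) *d q))
  (g := fun q => ε (iU u *d q))) => [||u0 v0]; try by lin.
by rewrite !iU_mul_cl !dcounit_cl -!pair_epsR epsR_epsR_mul.
Qed.

Lemma dcounit_epsLb_mul q u : ε (iU (epsLb HU u) *d q) = ε (iU u *d q).
Proof.
apply: (double_ext (W := K^o) (f := fun q => ε (iU (epsLb HU u) *d q))
  (g := fun q => ε (iU u *d q))) => [||u0 v0]; try by lin.
by rewrite !iU_mul_cl !dcounit_cl -!pair_epsR epsR_epsLb_mul.
Qed.

(** The reordered product contributes p(u, Si(v3) epsRb(v2) v1); here epsRb(v2) v1 collapses and the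
    antipode identity for [Si] gives [epsLb v]. *)
Lemma dcounit_iV_iU v u : ε (iV v *d iU u) = p u (epsLb HV v).
Proof.
rewrite double_mul_cl /dprod -sw2_coassoc //; last by lin.
rewrite -antipodeV_mul pair_swr (sw2_lin (W' := K^o) (f := fun z => ε z)); last by lin.
apply: eq_sw2K => y v3; rewrite -{2}(epsRb_mul whV y).
rewrite (sw2_lin (W' := K^o) (f := fun z => ε z)); last by lin.
rewrite (sw2_lin (W' := K^o) (f := fun z => p u (Si v3 *v z))); last by lin.
apply: eq_sw2K => v1 v2.
by rewrite (wh_mul1l whU) (wh_mul1r whV) dcounit_cl pair_act (wh_mulA whV).
Qed.

Lemma epsR_act u : exists2 y, inR HV y & epsR HU u = act 1u 1v y.
Proof.
(* The transpose [epsRb] tests v by ε(f v) p(u, e), that is ε(z v); passing from [z] to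
   [Sv z = epsR z] preserves this and lands in V_R. *)
pose z := swV 1v (fun e f => p u e *: f).
have Lz : inL HV z by apply: (inL_leg whV (φ := p u)); apply: (bil_form p).2.
exists (Sv z); first exact: inR_antipode.
apply: pair_extl => v; rewrite pair_epsR pair_act1 (wh_mul1r whV).
rewrite antipode_inL // counit_epsR_mul // pair_swr.
rewrite (sw2_lin (W' := K^o) (f := fun t => hcounit HV (t *v v))); last by lin.
by apply: eq_sw2K => e f; rewrite pairZr linearZl_LR linearZ mulrC.
Qed.

(** The U part of [q] may be replaced by an element of U_R and then moved into V. This leaves a
    counit of the form v u, which sees [u] only through [epsL u]. *)
Lemma dcounit_mul_iU_epsL q u : ε (q *d iU (epsL HU u)) = ε (q *d iU u).
Proof.
apply: (double_ext (W := K^o) (f := fun q => ε (q *d iU (epsL HU u)))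
  (g := fun q => ε (q *d iU u))) => [||u0 v0]; try by lin.
rewrite clE -!double_mulA -dcounit_epsR_mul -[RHS]dcounit_epsR_mul.
have [y Ry ->] := epsR_act u0.
rewrite -(iV_inR Ry) !double_mulA -!iVM !dcounit_iV_iU -!pair_epsL.
by rewrite (inL_epsL whU).
Qed.

Lemma dcounit_mul_cl q u v :
  ε (q *d cl u v) = ε (q *d iU (u *u act 1u (epsL HV v) 1v)).
Proof.
rewrite clE double_mulA -dcounit_mul_epsL iUM double_mulA iV_inL //.
exact: inL_epsL.
Qed.

Lemma dcounit_iU_mul_cl e u v :
  ε (iU e *d cl u v) = hcounit HU (e *u (u *u act 1u (epsL HV v) 1v)).
Proof. by rewrite dcounit_mul_cl -iUM dcounit_iU. Qed.

(** The right factor is first reduced to some w in U, then w to [epsRb w], whose defining sum is the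
    right side. The primed version expands [epsL w] instead. *)
Lemma dcounit_mul1 q q' :
  ε (q *d q') = swU (W := K^o) 1u (fun e f => ε (q *d iU e) * ε (iU f *d q')).
Proof.
apply: (double_ext (W := K^o) (f := fun q' => ε (q *d q')) (g := fun q' =>
  swU (W := K^o) 1u (fun e f => ε (q *d iU e) * ε (iU f *d q')))) => [||u v]; try by lin.
rewrite dcounit_mul_cl; set w := _ *u _.
rewrite -dcounit_mul_iU_epsL -[w in LHS](wh_mul1l whU) -(epsL_mul_epsRb whU).
rewrite (wh_mul1l whU) dcounit_mul_iU_epsL.
rewrite (sw2_lin (W' := K^o) (f := fun t => ε (q *d iU t))); last by lin.
apply: (eq_sw2 (W := K^o)) => e f; rewrite dcounit_iU_mul_cl -/w mulrC.
by rewrite (islinZ (W := K^o) (f := fun t => ε (q *d iU t))) //; lin.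
Qed.

Lemma dcounit_mul1' q q' :
  ε (q *d q') = swU (W := K^o) 1u (fun e f => ε (q *d iU f) * ε (iU e *d q')).
Proof.
apply: (double_ext (W := K^o) (f := fun q' => ε (q *d q')) (g := fun q' =>
  swU (W := K^o) 1u (fun e f => ε (q *d iU f) * ε (iU e *d q')))) => [||u v]; try by lin.
rewrite dcounit_mul_cl; set w := _ *u _.
rewrite -dcounit_mul_iU_epsL.
rewrite (sw2_lin (W' := K^o) (f := fun t => ε (q *d iU t))); last by lin.
apply: (eq_sw2 (W := K^o)) => e f; rewrite dcounit_iU_mul_cl -/w mulrC.
by rewrite (islinZ (W := K^o) (f := fun t => ε (q *d iU t))) //; lin.
Qed.

(** Under the counits the inner parts [v1] and [u2] become counital. Their sums then amount to Δ(1)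
    of the double placed between [u] and [v], where [dcounit_mul1] applies. *)
Lemma double_counitM1 x y z : ε (x *d y *d z) =
  swD (W := K^o) y (fun y1 y2 => ε (x *d y1) * ε (y2 *d z)).
Proof.
apply: (double_ext (W := K^o) (f := fun y => ε (x *d y *d z)) (g := fun y =>
  swD (W := K^o) y (fun y1 y2 => ε (x *d y1) * ε (y2 *d z)))) => [||u v]; try by lin.
rewrite sw2_cl; last by lin.
transitivity (swU (W := K^o) u (fun u1 u2 => swV (W := K^o) v (fun v1 v2 =>
    ε (x *d cl u1 (epsRb HV v1)) * ε (cl (epsLb HU u2) v2 *d z)))); last first.
  apply: (eq_sw2 (W := K^o)) => u1 u2; apply: (eq_sw2 (W := K^o)) => v1 v2.
  rewrite (clE u1 (epsRb HV v1)) (clE (epsLb HU u2) v2) (clE u1 v1) (clE u2 v2) !double_mulA.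
  rewrite dcounit_mul_epsRb; congr (_ * _).
  by rewrite -!double_mulA dcounit_epsLb_mul.
transitivity (swD (W := K^o) dunit (fun q1 q2 => ε (x *d iU u *d q1) * ε (q2 *d (iV v *d z)))).
  rewrite sw2_iU; last by lin.
  by rewrite -dcounit_mul1 clE !double_mulA.
rewrite sw2_cl; last by lin.
rewrite (sw2_epsLb whU (F := fun u1 u2 => swV (W := K^o) v (fun v1 v2 =>
    ε (x *d cl u1 (epsRb HV v1)) * ε (cl u2 v2 *d z)))); last by lin.
apply: (eq_sw2 (W := K^o)) => e f.
rewrite (sw2_epsRb whV (F := fun v1 v2 => (ε (x *d cl (u *u e) v1) * ε (cl f v2 *d z) : K^o)));
  last by lin.
apply: (eq_sw2 (W := K^o)) => e' f'.
by rewrite -double_mulA iU_mul_cl double_mulA cl_mul_iV.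
Qed.

Lemma double_counitM2 x y z : ε (x *d y *d z) =
  swD (W := K^o) y (fun y1 y2 => ε (x *d y2) * ε (y1 *d z)).
Proof.
apply: (double_ext (W := K^o) (f := fun y => ε (x *d y *d z)) (g := fun y =>
  swD (W := K^o) y (fun y1 y2 => ε (x *d y2) * ε (y1 *d z)))) => [||u v]; try by lin.
rewrite sw2_cl; last by lin.
transitivity (swU (W := K^o) u (fun u1 u2 => swV (W := K^o) v (fun v1 v2 =>
    ε (x *d cl u2 (epsL HV v2)) * ε (cl (epsR HU u1) v1 *d z)))); last first.
  apply: (eq_sw2 (W := K^o)) => u1 u2; apply: (eq_sw2 (W := K^o)) => v1 v2.
  rewrite (clE u2 (epsL HV v2)) (clE (epsR HU u1) v1) (clE u2 v2) (clE u1 v1) !double_mulA.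
  rewrite dcounit_mul_epsL; congr (_ * _).
  by rewrite -!double_mulA dcounit_epsR_mul.
transitivity (swD (W := K^o) dunit (fun q1 q2 => ε (x *d iU u *d q2) * ε (q1 *d (iV v *d z)))).
  rewrite sw2_iU; last by lin.
  by rewrite -dcounit_mul1' clE !double_mulA.
rewrite sw2_cl; last by lin.
rewrite (sw2_epsR whU (F := fun u1 u2 => swV (W := K^o) v (fun v1 v2 =>
    ε (x *d cl u2 (epsL HV v2)) * ε (cl u1 v1 *d z)))); last by lin.
apply: (eq_sw2 (W := K^o)) => e f.
rewrite (sw2_epsL whV (F := fun v1 v2 => (ε (x *d cl (u *u f) v2) * ε (cl e v1 *d z) : K^o)));
  last by lin.
apply: (eq_sw2 (W := K^o)) => e' f'.
by rewrite -double_mulA iU_mul_cl double_mulA cl_mul_iV.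
Qed.

(** * The antipode axioms *)

Lemma depsL_cl u v :
  epsL DD (cl u v) = iU (epsL HU (u *u act 1u (epsL HV v) 1v)).
Proof.
rewrite /epsL sw2_iU; last by lin.
rewrite [RHS](sw2_lin (f := fun t => iU t)); last by lin.
apply: eq_sw2 => e f; rewrite dcounit_iU_mul_cl.
by rewrite [RHS](islinZ (f := fun t => iU t)) //; lin.
Qed.

(** The sum over [v] closes up first, to [epsL v]; carried to U_L, it becomes part of the first leg
    of u t, and the sum over [u] closes up in U. *)
Lemma double_antipodeL x :
  swD x (fun x1 x2 => x1 *d hantipode DD x2) = epsL DD x.
Proof.
apply: (double_ext (f := fun x => swD x (fun x1 x2 => x1 *d hantipode DD x2))
  (g := fun x => epsL DD x)) => [||u v]; try by lin.
rewrite depsL_cl sw2_cl; last by lin.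
set t := act 1u (epsL HV v) 1v.
rewrite -(wh_antipodeL whU) sw2_mulL //; [|by lin|exact: inL_act].
rewrite [RHS](sw2_lin (f := fun z => iU z)); last by lin.
apply: eq_sw2 => u1 u2.
transitivity (iU u1 *d iV (epsL HV v) *d iU (Su u2)).
  rewrite -(wh_antipodeL whV) [RHS](sw2_lin (f := fun z => iU u1 *d iV z *d iU (Su u2)));
    last by lin.
  by apply: eq_sw2 => v1 v2; rewrite dantipode_cl (clE u1) iVM !double_mulA.
by rewrite !iUM iV_inL //; apply: inL_epsL.
Qed.

(** Here the sum over [u] closes up first and is carried to V by [epsR_act]; accordingly Δ(1) is
    taken from V, not from U as in [depsL_cl]. *)
Lemma double_antipodeR x :
  swD x (fun x1 x2 => hantipode DD x1 *d x2) = epsR DD x.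
Proof.
apply: (double_ext (f := fun x => swD x (fun x1 x2 => hantipode DD x1 *d x2))
  (g := fun x => epsR DD x)) => [||u v]; try by lin.
have [y Ry yE] := epsR_act u.
transitivity (iV (epsR HV (y *v v))).
  rewrite sw2_cl; last by lin.
  rewrite sw2_exch -(wh_antipodeR whV) sw2_Rmul //; last by lin.
  rewrite [RHS](sw2_lin (f := fun z => iV z)); last by lin.
  apply: eq_sw2 => v1 v2.
  rewrite !iVM (iV_inR Ry) -yE -(wh_antipodeR whU).
  rewrite [RHS](sw2_lin (f := fun z => iV (Sv v1) *d (iU z *d iV v2))); last by lin.
  by apply: eq_sw2 => u1 u2; rewrite dantipode_cl (clE u2) iUM !double_mulA.
rewrite /epsR sw2_iV; last by lin.
rewrite (sw2_lin (f := fun z => iV z)); last by lin.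
apply: eq_sw2 => e f; rewrite (islinZ (f := fun t => iV t)); last by lin.
rewrite cl_mul_iV (clE u (v *v f)) -dcounit_epsR_mul yE -(iV_inR Ry) -iVM dcounit_iV.
by rewrite (wh_mulA whV).
Qed.

(** Expanded, the sum is S(a) b t S(c); S(a) b collapses to an element of U_R, which commutes with
    [t]. This brings the counital part of v in front of S(u) in [double_antipode3]. *)
Lemma antipode_mul_epsL u t : inL HU t ->
  swU u (fun a b => Su a *u epsL HU (b *u t)) = t *u Su u.
Proof.
move=> Lt.
transitivity (swU u (fun a y => swU y (fun b c => Su a *u b *u t *u Su c))).
  apply: eq_sw2 => a y; rewrite -(wh_antipodeL whU) sw2_mulL //; last by lin.
  rewrite (sw2_lin (f := fun z => Su a *u z)); last by lin.
  by apply: eq_sw2 => b c; rewrite !(wh_mulA whU).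
rewrite -sw2_coassoc //; last by lin.
rewrite -[Su u](antipode_epsR whU) [RHS](sw2_lin (f := fun z => t *u z)); last by lin.
apply: eq_sw2 => y c.
rewrite (wh_mulA whU) (inLR_comm whU Lt (inR_epsR whU y)).
rewrite -(wh_antipodeR whU) [RHS](sw2_lin (f := fun z => z *u t *u Su c)) //.
by lin.
Qed.

Lemma double_antipode3 x :
  sw3 DD x (fun x1 x2 x3 => hantipode DD x1 *d x2 *d hantipode DD x3) =
  hantipode DD x.
Proof.
rewrite /sw3 double_coassoc; last by lin.
transitivity (swD x (fun a y => hantipode DD a *d epsL DD y)).
  apply: eq_sw2 => a y; rewrite -double_antipodeL.
  rewrite [RHS](sw2_lin (f := fun z => hantipode DD a *d z)); last by lin.
  by apply: eq_sw2 => b c; rewrite double_mulA.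
apply: (double_ext (f := fun x => swD x (fun a y => hantipode DD a *d epsL DD y))
  (g := fun x => hantipode DD x)) => [||u v]; try by lin.
rewrite sw2_cl; last by lin.
rewrite sw2_exch dantipode_cl -[Sv v in RHS](antipode_epsL whV).
rewrite [RHS](sw2_lin (f := fun z => iV z *d iU (Su u))); last by lin.
apply: eq_sw2 => v1 v2.
rewrite iVM -double_mulA (iV_inL (inL_epsL whV v2)).
rewrite -iUM -(antipode_mul_epsL _ (inL_act _)).
rewrite [RHS](sw2_lin (f := fun z => iV (Sv v1) *d iU z)); last by lin.
by apply: eq_sw2 => u1 u2; rewrite dantipode_cl depsL_cl iUM double_mulA.
Qed.

Lemma double_weak_hopf : weak_hopf DD.
Proof.
split.
- exact: double_mulA.
- exact: dmul1d.
- exact: dmuld1.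
- by move=> x; rewrite /sw3 double_coassoc //; lin.
- exact: double_counitl.
- exact: double_counitr.
- exact: double_comulM.
- exact: double_counitM1.
- exact: double_counitM2.
- exact: double_comul1l.
- exact: double_comul1r.
- exact: double_antipodeL.
- exact: double_antipodeR.
- exact: double_antipode3.
Qed.

End Pairing.

Theorem theorem15 (R : realType) (U V : vectType R[i])
    (HU : hopf_data U) (HV : hopf_data V)
    (p : {bilinear U -> V -> R[i] | *%R & *%R})
    (whU : weak_hopf HU) (whV : weak_hopf HV)
    (sp : skew_pairing HU HV p) (nd : nondegenerate_pairing p) :
  let cl := dclass HU HV p in
  exists D : hopf_data (drinfeld_double HU HV p),
    [/\ hone D = cl (hone HU) (hone HV),
        forall u v u' v', hmul D (cl u v) (cl u' v') =
          sw3 HU u' (fun u1 u2 u3 => sw3 HV v (fun v1 v2 v3 =>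
            (p u1 v1 * p u3 (antipodeV HV v3)) *:
              cl (hmul HU u u2) (hmul HV v2 v'))),
        forall u v, hcomul D (cl u v) =
          sw2 HU u (fun u1 u2 => sw2 HV v (fun v1 v2 => cl u1 v1 ⊗ cl u2 v2)),
        forall u v, hcounit D (cl u v) = p u (epsR HV (antipodeV HV v)) &
        forall u v, hantipode D (cl u v) =
          sw3 HU u (fun u1 u2 u3 => sw3 HV v (fun v1 v2 v3 =>
            (p u3 v3 * p u1 (antipodeV HV v1)) *:
              cl (hantipode HU u2) (hantipode HV v2)))] /\
    weak_hopf D.
Proof.
exists (double_data HU HV p); split; last exact: double_weak_hopf.
split=> [|u v u' v'|u v|u v|u v].
- by [].
- by rewrite double_mul_cl // dprodE.
- exact: dcomul_cl.
- by rewrite dcounit_cl // (epsR_antipodeV whU whV sp nd).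
- exact: dantipode_clE.
Qed.
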